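(* For every integer $d\ge2$ there exist constants $n_0\in\mathbb{N}$ and $C_1,C_2,c,\theta>0$, depending only on $d$, such that the following holds for every $n\ge n_0$. Let $f=(f_{\mathbf i})_{\mathbf i\in[n]^d}$ be a real multilinear polynomial of degree $d$ with $f\not\equiv0$, and let $\xi_1,\dots,\xi_d\in\{\pm1\}^n$ be independent Rademacher vectors. Then for every integer $r\in\{1,\dots,n\}$, $$\sup_{x\in\mathbb{R}}\mathbb{P}\left\{\mathrm{Res}_x^f(\xi_1,\dots,\xi_d)\le r\right\}\le C_1\,\log^{d/2}(n)\sum_{\emptyset\ne I\subseteq[d]}r^{|I|}\max_{d_I\in[n]^{I}}\frac{\|f_{I,d_I}\|_{\mathsf F}}{\|f\|_{\mathsf F}}+C_2\exp\left(-c\left(\frac{\|f\|_{\mathsf F}^2}{\Gamma(f)}\right)^{1/\theta}\right),$$ where $$\Gamma(f)=\max_{i\in[d]}\ \max_{\substack{k\in[2(d-1)]\\ k\text{ even}}}\Gamma_{i,k}(f).$$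
   Context: $[n]=\{1,\dots,n\}$. A Rademacher vector is a random vector whose entries are i.i.d. and uniform on $\{-1,1\}$. Polynomials: a real tensor $f=(f_{\mathbf i})_{\mathbf i\in[n]^d}$ is identified with the multilinear polynomial $f(x_1,\dots,x_d)=\sum_{\mathbf i\in[n]^d}f_{\mathbf i}\,(x_1)_{\mathbf i_1}\cdots(x_d)_{\mathbf i_d}$, $x_1,\dots,x_d\in\mathbb{R}^n$. $f\not\equiv0$ means at least one coefficient is non-zero. $\|f\|_{\mathsf F}=\big(\sum_{\mathbf i}f_{\mathbf i}^2\big)^{1/2}$. Resilience: $\mathrm{Res}_x^f(v_1,\dots,v_d)$, for $v_1,\dots,v_d\in\{\pm1\}^n$ and $x\in\mathbb{R}$, is the Hamming distance (in $\{\pm1\}^{dn}$) from $(v_1,\dots,v_d)$ to the level set $\{(u_1,\dots,u_d)\in(\{\pm1\}^n)^d: f(u_1,\dots,u_d)=x\}$; it is $+\infty$ if this set is empty. Restrictions: for $\emptyset\ne I\subseteq[d]$ and $d_I=(d_i)_{i\in I}\in[n]^I$, $f_{I,d_I}$ is the $(d-|I|)$-mode tensor obtained from $f$ by fixing the $i$-th index to be $d_i$ for every $i\in I$; $\|f_{I,d_I}\|_{\mathsf F}$ is the square root of the sum of squares of its coefficients (the absolute value of a single coefficient if $I=[d]$). The quantities $\Gamma_{i,k}(f)$: for $i\in[d]$ let $\mathcal A_i$ be the $n\times n^{d-1}$ matrix with rows indexed by $j\in[n]$, columns indexed by $\boldsymbol\ell=(\ell_1,\dots,\ell_{i-1},\ell_{i+1},\dots,\ell_d)\in[n]^{d-1}$,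 and entries $(\mathcal A_i)_{j,\boldsymbol\ell}=f_{(\ell_1,\dots,\ell_{i-1},j,\ell_{i+1},\dots,\ell_d)}$. For $\mathbf j\in[n]^{d-1}$ let $$\varphi_i(\mathbf j)=\big((1,\mathbf j_1),\dots,(i-1,\mathbf j_{i-1}),(i+1,\mathbf j_i),\dots,(d,\mathbf j_{d-1})\big),$$ a sequence of $d-1$ distinct pairs in $([d]\setminus\{i\})\times[n]$. For even $k\in[2(d-1)]$, let $\mathrm{Rel}_{i,k}$ be the set of tuples $$\boldsymbol\ell=\big((b_1,c_1),\dots,(b_{k/2},c_{k/2}),(b_1,c_1'),\dots,(b_{k/2},c_{k/2}')\big)\in\big(([d]\setminus\{i\})\times[n]\big)^k$$ with $b_1,\dots,b_{k/2}$ pairwise distinct and $c_s\ne c_s'$ for every $s\in[k/2]$. For such $\boldsymbol\ell$ let $\mathrm{Ext}_{i,k}(\boldsymbol\ell)$ be the set of pairs $(\mathbf j,\mathbf k)\in[n]^{d-1}\times[n]^{d-1}$ such that $(\varphi_i(\mathbf j)\cup\varphi_i(\mathbf k))\setminus(\varphi_i(\mathbf j)\cap\varphi_i(\mathbf k))=\boldsymbol\ell$, where sequences are regarded as sets of their entries. Define $\Gamma_{i,k}(f)\ge0$ by $$\Gamma_{i,k}(f)^2=\sum_{\boldsymbol\ell\in\mathrm{Rel}_{i,k}}\Big(\sum_{(\mathbf j,\mathbf k)\in\mathrm{Ext}_{i,k}(\boldsymbol\ell)}(\mathcal A_i^{\mathsf T}\mathcal A_i)_{\mathbf j\mathbf k}\Big)^2.$$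 A ratio with denominator $0$ and positive numerator is read as $+\infty$, and $\exp(-\infty)=0$. *)

(* Defs.v *)
From mathcomp Require Import all_boot all_order all_algebra.
From mathcomp Require Import all_classical all_reals all_analysis.

Set Implicit Arguments.
Unset Strict Implicit.
Unset Printing Implicit Defensive.

Import Order.TTheory GRing.Theory Num.Theory.

Local Open Scope ring_scope.

(* Real tensors whose modes are indexed by the finite type D, each mode having
   index set 'I_n; D = 'I_d gives the tensors indexed by [n]^d. *)
Definition tensor (R : realType) (D : finType) (n : nat) : Type :=
  {ffun {ffun D -> 'I_n} -> R}.

Section Tensors.
Context (R : realType).

Definition frobenius (D : finType) n (f : tensor R D n) : R :=
  Num.sqrt (\sum_(i : {ffun D -> 'I_n}) f i ^+ 2).

Definition multilinear_eval d n (f : tensor R 'I_d n)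
    (x : 'I_d -> 'rV[R]_n) : R :=
  \sum_(i : {ffun 'I_d -> 'I_n}) f i * \prod_(k < d) x k 0 (i k).

Definition merge_index (D : finType) n (I : {set D})
    (dI : {ffun {k : D | k \in I} -> 'I_n})
    (l : {ffun {k : D | k \notin I} -> 'I_n}) : {ffun D -> 'I_n} :=
  [ffun k => match boolP (k \in I) with
             | AltTrue kI => dI (exist _ k kI)
             | AltFalse kI => l (exist _ k kI)
             end].

Definition restriction (D : finType) n (f : tensor R D n) (I : {set D})
    (dI : {ffun {k : D | k \in I} -> 'I_n}) :
    tensor R {k : D | k \notin I} n :=
  [ffun l => f (merge_index dI l)].

End Tensors.

(* {-1,1}^n: the bit b stands for the sign (-1) ^+ b, so that false encodes 1
   and true encodes -1. *)
Definition cube (n : nat) : finType := {ffun 'I_n -> bool}.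

Definition sign_vector (R : realType) n (u : cube n) : 'rV[R]_n :=
  \row_j (-1) ^+ (u j).

Definition hamming d n (u v : 'I_d -> cube n) : nat :=
  #|[set p : 'I_d * 'I_n | u p.1 p.2 != v p.1 p.2]|.

(* Extended-real valued: the infimum over the empty set is +oo. *)
Definition resilience (R : realType) d n (f : tensor R 'I_d n) (x : R)
    (v : 'I_d -> cube n) : \bar R :=
  ereal_inf [set ((hamming v u)%:R%:E : \bar R) | u in
    [set u : 'I_d -> cube n |
       multilinear_eval f (fun k => sign_vector R (u k)) = x]]%classic.

Section Probability.
Context (R : realType) (disp : measure_display) (T : measurableType disp).
Context (P : probability T R).

(* The finite type S carries its discrete sigma-algebra. *)
Definition random_element (S : finType) (X : T -> S) : Prop :=
  forall A : set S, measurable (X @^-1` A)%classic.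

Definition mutually_independent (I S : finType) (X : I -> T -> S) : Prop :=
  forall (J : {set I}) (A : I -> set S),
    P (\bigcap_(i in [set` J]) (X i @^-1` A i))%classic =
    (\prod_(i in J) P (X i @^-1` A i)%classic)%E.

Definition rademacher n (X : T -> cube n) : Prop :=
  [/\ random_element X,
      mutually_independent (fun (j : 'I_n) w => X w j) &
      forall (j : 'I_n) (b : bool),
        P [set w | X w j = b]%classic = (2^-1)%:E].

Definition independent_rademacher d n (xi : 'I_d -> T -> cube n) : Prop :=
  (forall k : 'I_d, rademacher (xi k)) /\ mutually_independent xi.

End Probability.

Section Gamma.
Context (R : realType) (d n : nat).
Implicit Types (i : 'I_d) (f : tensor R 'I_d n) (k : nat).

Definition insert_index i (j : 'I_n) (l : {ffun 'I_d.-1 -> 'I_n}) :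
    {ffun 'I_d -> 'I_n} :=
  [ffun s => if unlift i s is Some t then l t else j].

(* The columns, indexed by [n]^(d-1), are numbered by enum_rank. *)
Definition unfolding f i : 'M[R]_(n, #|{ffun 'I_d.-1 -> 'I_n}|) :=
  \matrix_(j, c) f (insert_index i j (enum_val c)).

Definition gram_entry f i (j k : {ffun 'I_d.-1 -> 'I_n}) : R :=
  ((unfolding f i)^T *m unfolding f i) (enum_rank j) (enum_rank k).

(* lift i enumerates the modes other than i in increasing order. *)
Definition phi i (j : {ffun 'I_d.-1 -> 'I_n}) : {set 'I_d * 'I_n} :=
  [set (lift i s, j s) | s : 'I_d.-1].

Definition Rel i k : {set k.-tuple ('I_d * 'I_n)} :=
  [set l : k.-tuple ('I_d * 'I_n) |
    [exists b : (k./2).-tuple 'I_d, exists c : (k./2).-tuple 'I_n,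
     exists c' : (k./2).-tuple 'I_n,
       [&& tval l == zip b c ++ zip b c', i \notin b, uniq b &
           [forall s : 'I_(k./2), tnth c s != tnth c' s]]]].

Definition Ext i k (l : k.-tuple ('I_d * 'I_n)) :
    {set {ffun 'I_d.-1 -> 'I_n} * {ffun 'I_d.-1 -> 'I_n}} :=
  [set jk | (phi i jk.1 :|: phi i jk.2) :\: (phi i jk.1 :&: phi i jk.2)
            == [set p in l]].

Definition Gamma_ik f i k : R :=
  Num.sqrt (\sum_(l in Rel i k)
              (\sum_(jk in Ext i l) gram_entry f i jk.1 jk.2) ^+ 2).

(* All the maximized quantities are nonnegative, so 0 is a neutral default. *)
Definition Gamma f : R :=
  \big[Num.max/0]_(i < d)
    \big[Num.max/0]_(1 <= k < (2 * d.-1).+1 | ~~ odd k) Gamma_ik f i k.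

End Gamma.

(* Main.v *)
Require Import Defs.
From mathcomp Require Import all_boot all_order all_algebra.
From mathcomp Require Import all_classical all_reals all_analysis.
From mathcomp Require Import ring lra zify.

Import Order.TTheory GRing.Theory Num.Theory.
Import numFieldNormedType.Exports.

Local Open Scope ring_scope.

(** The resilience is at most r at a configuration u when some u' at Hamming
    distance at most r from u satisfies f(u') = x. Flipping r signs moves the
    value of f by a sum, over the nonempty sets I of modes, of at most
    (2 r)^|I| values of restrictions f_{I,d_I} at u ([form_perturbation]).
    Each restriction is a Rademacher chaos of degree at most d - 1, so with
    high probability all of them are at most of order log(n)^(d/2) times their
    Frobenius norms ([slices_tail], which rests on [hypercontractivity]).
    Hence f(u) itself lies within a distance t of x, where t / ||f|| is the
    first term of the bound up to a constant, and a small ball estimate for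
    f(u) remains.

    For this estimate all modes but one are frozen. As a function of the last
    Rademacher vector, f is a linear form whose coefficients a_j are
    restrictions of f to a single index, so they are at most t on the same
    event. By an argument of Esseen, carried out with a Fejer kernel so that
    all sums are finite ([small_ball]), such a linear form hits an interval of
    radius t with probability of order t / ||a||. The squared norm ||a||^2 is a
    chaos of degree at most 2 (d - 1) with mean ||f||^2, and its other
    coefficients, collected monomial by monomial, are the inner sums of the
    definition of Gamma ([symdiff_variance]). So ||a||^2 is at least
    ||f||^2 / 2 except with the probability of the second term of the bound,
    again by hypercontractivity, with theta = d ([coef_tail_expR]).

    The failure probability of the bound for the restrictions is of order 1 / n,
    and 1 / n is at most the first term because one of the n restrictions to a
    single index carries at least a fraction 1 / n of the squared norm
    ([invn_le_ratio_sum]).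

    The argument takes place under the uniform measure on the cube of all d n
    signs; independence enters only in showing that the d vectors have this
    joint distribution ([pack_law]). *)

Set Implicit Arguments.
Unset Strict Implicit.
Unset Printing Implicit Defensive.

(** * Hypercontractivity on the discrete cube *)

(** Averaging over the sign of b keeps the even part of the power only; as K is
    at least 4 q, weighting b ^ 2 by K absorbs the binomial coefficients. *)
Lemma two_point (R : realFieldType) (a b K : R) (q : nat) :
  (4 * q)%:R <= K ->
  ((a + b) ^+ (2 * q) + (a - b) ^+ (2 * q)) / 2 <= (a ^+ 2 + K * b ^+ 2) ^+ q.
Proof.
move=> qK.
have K0 : 0 <= K by apply: le_trans qK; rewrite ler0n.
set M := a ^+ 2 + K * b ^+ 2.
have M0 : 0 <= M by rewrite /M addr_ge0 ?sqr_ge0// mulr_ge0 ?sqr_ge0.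
have sqM m : (4 * m <= 4 * q)%N -> a ^+ 2 + (4 * m)%:R * b ^+ 2 <= M.
  move=> mq; rewrite /M lerD2l ler_wpM2r ?sqr_ge0//.
  by apply: le_trans qK; rewrite ler_nat.
(* The odd part of (a + b) ^ 2m is carried along, times a * b, which makes it
   a polynomial in b ^ 2. *)
suff H m : (m <= q)%N ->
    ((a + b) ^+ (2 * m) + (a - b) ^+ (2 * m)) / 2 <= M ^+ m /\
    a * b * (((a + b) ^+ (2 * m) - (a - b) ^+ (2 * m)) / 2)
      <= (2 * m)%:R * b ^+ 2 * M ^+ m by have [] := H q (leqnn q).
elim: m => [|m IH] mq.
  by rewrite !muln0 !expr0; split; lra.
have [IH1 IH2] := IH (ltnW mq).
have eX (x : R) : x ^+ (2 * m.+1) = x ^+ 2 * x ^+ (2 * m).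
  by rewrite mulnS exprD.
rewrite !eX [M ^+ _]exprS mulnS.
set X := (a + b) ^+ (2 * m) in IH1 IH2 *.
set Y := (a - b) ^+ (2 * m) in IH1 IH2 *.
set Z := M ^+ m in IH1 IH2 *.
have Z0 : 0 <= Z by rewrite exprn_ge0.
clearbody X Y Z.
have a2b2 : 0 <= a ^+ 2 + b ^+ 2 by rewrite addr_ge0 ?sqr_ge0.
have H1 := ler_wpM2l a2b2 IH1.
have H2 := ler_wpM2l a2b2 IH2.
have ab2 : 0 <= 2 * a ^+ 2 * b ^+ 2
  by rewrite mulr_ge0 ?sqr_ge0// mulr_ge0 ?sqr_ge0.
have H3 := ler_wpM2l ab2 IH1.
have := sqM m.+1; rewrite leq_mul2l mq orbT => /(_ isT) HM.
have H4 := ler_wpM2r Z0 HM.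
split.
  apply: le_trans H4.
  rewrite -[leLHS](_ : (a ^+ 2 + b ^+ 2) * ((X + Y) / 2) +
    2 * (a * b * ((X - Y) / 2)) = _); last by field.
  have -> : (4 * m.+1)%:R = 2 * (2 * m)%:R + 4 :> R.
    by ring.
  have H5 : 0 <= b ^+ 2 * Z by rewrite mulr_ge0 ?sqr_ge0.
  lra.
rewrite -[leLHS](_ : (a ^+ 2 + b ^+ 2) * (a * b * ((X - Y) / 2)) +
    2 * a ^+ 2 * b ^+ 2 * ((X + Y) / 2) = _); last by field.
have HM1 : a ^+ 2 + b ^+ 2 <= M.
  apply: le_trans HM; rewrite lerD2l ler_peMl ?sqr_ge0//.
  by rewrite ler1n muln_gt0.
have cZ : 0 <= (2 * m.+1)%:R * b ^+ 2 * Z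
  by rewrite mulr_ge0// mulr_ge0 ?sqr_ge0.
have H5 := ler_wpM2l cZ HM1.
have -> : (2 + 2 * m)%:R = (2 * m.+1)%:R :> R by ring.
have e1 : (2 * m.+1)%:R = (2 * m)%:R + 2 :> R by ring.
rewrite e1 in H5 *.
have b2Z : 0 <= b ^+ 2 * Z * b ^+ 2
  by rewrite mulr_ge0 ?sqr_ge0// mulr_ge0 ?sqr_ge0.
lra.
Qed.

Lemma convex_exprn (R : realFieldType) (l m x y : R) (p : nat) :
  0 <= l -> 0 <= m -> l + m = 1 -> 0 <= x -> 0 <= y ->
  (l * x + m * y) ^+ p <= l * x ^+ p + m * y ^+ p.
Proof.
move=> l0 m0 lm x0 y0; elim: p => [|p IH]; first by rewrite !expr0 !mulr1 lm.
have c0 : 0 <= l * x + m * y by rewrite addr_ge0 ?mulr_ge0.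
rewrite exprS (le_trans (ler_wpM2l c0 IH))// !exprS.
have H : 0 <= (x - y) * (x ^+ p - y ^+ p).
  have [xy|/ltW xy] := leP x y.
    by rewrite mulr_le0 ?subr_le0// lerXn2r.
  by rewrite mulr_ge0 ?subr_ge0// lerXn2r.
have -> : m = 1 - l by rewrite -lm addrC addKr.
have : 0 <= l * (1 - l) * ((x - y) * (x ^+ p - y ^+ p)).
  by rewrite mulr_ge0// mulr_ge0// -lm addrC addKr.
lra.
Qed.

Section Cube.
Context (R : realFieldType) (V : finType).
Implicit Types (u : {ffun V -> bool}) (g h : {ffun V -> bool} -> R) (v : V).

Definition mean g : R := (\sum_u g u) / #|{ffun V -> bool}|%:R.

Definition sgn u v : R := (-1) ^+ u v.

Definition chi (S : {set V}) u : R := \prod_(v in S) sgn u v.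

Definition flip v u : {ffun V -> bool} :=
  [ffun w => if w == v then ~~ u w else u w].

Lemma cube_gt0 : 0 < #|{ffun V -> bool}|%:R :> R.
Proof. by rewrite ltr0n; apply/card_gt0P; exists [ffun=> false]. Qed.

Lemma eq_mean g h : g =1 h -> mean g = mean h.
Proof. by move=> gh; congr (_ / _); apply: eq_bigr. Qed.

Lemma meanD g h : mean (fun u => g u + h u) = mean g + mean h.
Proof. by rewrite /mean big_split mulrDl. Qed.

Lemma meanZ (c : R) g : mean (fun u => c * g u) = c * mean g.
Proof. by rewrite /mean -mulr_sumr mulrA. Qed.

Lemma mean_sum (I : Type) (s : seq I) (P : pred I)
    (G : I -> {ffun V -> bool} -> R) :
  mean (fun u => \sum_(i <- s | P i) G i u) = \sum_(i <- s | P i) mean (G i).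
Proof. by rewrite /mean exchange_big mulr_suml. Qed.

Lemma mean_cst (c : R) : mean (fun=> c) = c.
Proof.
by rewrite /mean sumr_const -[X in X / _]mulr_natr mulfK// gt_eqF// cube_gt0.
Qed.

Lemma ler_mean g h : (forall u, g u <= h u) -> mean g <= mean h.
Proof.
by move=> gh; rewrite /mean ler_wpM2r ?invr_ge0 ?(ltW cube_gt0)// ler_sum.
Qed.

Lemma mean_ge0 g : (forall u, 0 <= g u) -> 0 <= mean g.
Proof. by move=> g0; rewrite -[leLHS](mean_cst 0) ler_mean. Qed.

Lemma flipK v : involutive (flip v).
Proof.
by move=> u; apply/ffunP => w; rewrite !ffunE; case: eqP => // _; rewrite negbK.
Qed.

Lemma mean_flip v g : mean (fun u => g (flip v u)) = mean g.
Proof.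
congr (_ / _); symmetry; rewrite (reindex_inj (inv_inj (flipK v))).
exact: eq_bigr.
Qed.

(** Expectations over the cube are computed one sign at a time through
    this identity, so that conditioning on the other signs needs no product
    decomposition of the cube: it is enough to know which functions are
    invariant under which flips. *)
Lemma mean_symmetrize v g : mean g = mean (fun u => (g u + g (flip v u)) / 2).
Proof.
under [RHS]eq_mean do rewrite mulrC.
by rewrite meanZ meanD mean_flip; field.
Qed.

Lemma sgn_flip v u : sgn (flip v u) v = - sgn u v.
Proof. by rewrite /sgn ffunE eqxx; case: (u v); rewrite ?opprK. Qed.

Lemma sgn_flip_neq v w u : w != v -> sgn (flip v u) w = sgn u w.
Proof. by rewrite /sgn ffunE => /negPf ->. Qed.

Lemma sgn_sqr u v : sgn u v ^+ 2 = 1.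
Proof. exact: sqrr_sign. Qed.

Lemma chi_flip v (S : {set V}) u : v \notin S -> chi S (flip v u) = chi S u.
Proof.
move=> vS; apply: eq_bigr => w wS; apply: sgn_flip_neq.
by apply: contraNneq vS => <-.
Qed.

Lemma big_subset_setU1 (A : {set V}) v (F : {set V} -> R) : v \notin A ->
  \sum_(S : {set V} | S \subset v |: A) F S =
  \sum_(S : {set V} | S \subset A) F S +
  \sum_(S : {set V} | S \subset A) F (v |: S).
Proof.
move=> vA; rewrite (bigID (fun S : {set V} => v \in S)) /= addrC; congr (_ + _).
  by apply: eq_bigl => S; rewrite -finset.subsetD1 finset.setU1K.
rewrite (reindex_onto (fun S => v |: S) (fun S => S :\ v)) /=; last first.
  by move=> S /andP[_ vS]; rewrite finset.setD1K.
apply: eq_bigl => S; rewrite setU11 andbT.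
have -> : (S \subset A) = (S \subset v |: A) && (v \notin S).
  by rewrite -finset.subsetD1 finset.setU1K.
apply/andP/andP => [[SA /eqP eS]|[SA vS]].
  by rewrite -{2}eS finset.setD11 (fintype.subset_trans _ SA)// finset.subsetUr.
by rewrite finset.setU1K// eqxx finset.subUset finset.sub1set finset.setU11.
Qed.

(** The triangle inequality of the norm of L^p, in a form without roots:
    (a + b) / (s + t) is the convex combination of a / s and b / t with
    weights s / (s + t) and t / (s + t), and the p-th power is convex. For
    p > 0, if s = 0 or t = 0 then a or b vanishes on the whole cube. *)
Lemma minkowski (a b : {ffun V -> bool} -> R) (s t : R) (p : nat) :
  (forall u, 0 <= a u) -> (forall u, 0 <= b u) -> 0 <= s -> 0 <= t ->
  mean (fun u => a u ^+ p) <= s ^+ p -> mean (fun u => b u ^+ p) <= t ^+ p ->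
  mean (fun u => (a u + b u) ^+ p) <= (s + t) ^+ p.
Proof.
case: p => [|p] a0 b0 s0 t0 ha hb.
  by under eq_mean do rewrite expr0; rewrite mean_cst.
have zero (c : {ffun V -> bool} -> R) : (forall u, 0 <= c u) ->
    mean (fun u => c u ^+ p.+1) <= 0 ^+ p.+1 -> forall u, c u = 0.
  move=> c0; rewrite expr0n /= => hc u.
  have : \sum_u c u ^+ p.+1 = 0.
    apply: le_anti; rewrite sumr_ge0 ?andbT; last by move=> *; rewrite exprn_ge0.
    by move: hc; rewrite /mean pmulr_lle0// invr_gt0 cube_gt0.
  move/psumr_eq0P => /(_ (fun u _ => exprn_ge0 _ (c0 u)))/(_ u isT)/eqP.
  by rewrite expf_eq0 /= => /eqP.
move: s0; rewrite le_eqVlt => /orP[/eqP s0|s0].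
  have a00 := zero _ a0; rewrite -{}s0 in ha *.
  by under eq_mean do rewrite a00// add0r; rewrite add0r.
move: t0; rewrite le_eqVlt => /orP[/eqP t0|t0].
  have b00 := zero _ b0; rewrite -{}t0 in hb *.
  by under eq_mean do rewrite b00// addr0; rewrite addr0.
have st0 : 0 < s + t by rewrite addr_gt0.
have stN := lt0r_neq0 st0.
pose w c := c / (s + t) : R.
apply: (@le_trans _ _ (mean (fun u => (s + t) ^+ p.+1 *
    (w s * (a u / s) ^+ p.+1 + w t * (b u / t) ^+ p.+1)))).
  apply: ler_mean => u.
  have -> : a u + b u = (s + t) * (w s * (a u / s) + w t * (b u / t)).
    by rewrite /w; field; rewrite stN !gt_eqF.
  rewrite exprMn ler_wpM2l ?exprn_ge0 ?(ltW st0)//.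
  apply: convex_exprn; rewrite /w ?divr_ge0 ?(ltW s0) ?(ltW t0) ?(ltW st0)//.
  by rewrite -mulrDl divff.
rewrite meanZ -[leRHS]mulr1 ler_pM2l ?exprn_gt0//.
rewrite meanD !meanZ.
have bnd (c : R) (g : {ffun V -> bool} -> R) : 0 < c ->
    mean (fun u => g u ^+ p.+1) <= c ^+ p.+1 ->
    mean (fun u => (g u / c) ^+ p.+1) <= 1.
  move=> c0 hg; under eq_mean do rewrite expr_div_n mulrC.
  by rewrite meanZ mulrC ler_pdivrMr ?mul1r ?exprn_gt0.
have ws : 0 <= w s by rewrite divr_ge0 ?ltW.
have wt : 0 <= w t by rewrite divr_ge0 ?ltW.
have -> : 1 = w s * 1 + w t * 1 by rewrite !mulr1 /w -mulrDl divff.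
by rewrite lerD// ler_wpM2l// bnd.
Qed.

(** Bonami's inequality, by induction on the set of variables. Singling out a
    variable v, the polynomial is a + x_v b with a and b free of v; two_point
    averages out x_v at each point, and minkowski combines the bounds which
    the induction gives for the moments of a and of b. Weighting each
    coefficient by K ^ #|S|, instead of bounding the degree, is what makes the
    induction close: passing from S to v |: S costs exactly the factor K of
    two_point. *)
Lemma hypercontractivity (p : nat) (K : R) (c : {set V} -> R) :
  (4 * p)%:R <= K ->
  mean (fun u => (\sum_(S : {set V}) c S * chi S u) ^+ (2 * p))
    <= (\sum_(S : {set V}) K ^+ #|S| * c S ^+ 2) ^+ p.
Proof.
move=> pK; have K0 : 0 <= K by apply: le_trans pK; rewrite ler0n.
suff H (A : {set V}) : mean (fun u =>
      (\sum_(S : {set V} | S \subset A) c S * chi S u) ^+ (2 * p))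
    <= (\sum_(S : {set V} | S \subset A) K ^+ #|S| * c S ^+ 2) ^+ p.
  have := H [set: V]; rewrite (eq_bigl _ _ (@finset.subsetT _)).
  by under eq_mean do rewrite (eq_bigl _ _ (@finset.subsetT _)).
move: {2}#|A| (erefl #|A|) c => m; elim: m A => [|m IH] A.
  move=> /eqP; rewrite finset.cards_eq0 => /eqP -> c.
  under eq_mean do (under eq_bigl do rewrite finset.subset0;
    rewrite big_pred1_eq /chi big_set0 mulr1).
  rewrite mean_cst; under eq_bigl do rewrite finset.subset0.
  by rewrite big_pred1_eq finset.cards0 expr0 mul1r exprM.
move=> Am; have /card_gt0P[v vA] : (0 < #|A|)%N by rewrite Am.
rewrite -(finset.setD1K vA); set B := A :\ v => c.
have vB : v \notin B by rewrite finset.setD11.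
have cB : #|B| = m by move: Am; rewrite (cardsD1 v) vA => -[].
pose a u := \sum_(S : {set V} | S \subset B) c S * chi S u.
pose b u := \sum_(S : {set V} | S \subset B) c (v |: S) * chi S u.
have vS (S : {set V}) : S \subset B -> v \notin S.
  by move=> SB; apply: contra vB; apply: (fintype.subsetP SB).
under eq_mean => u.
  rewrite big_subset_setU1// -/(a u) (_ : \sum_(S | _) _ = sgn u v * b u).
    over.
  rewrite mulr_sumr; apply: eq_bigr => S SB.
  rewrite /chi finset.big_setU1 ?vS// mulrCA; exact.
have fa u : a (flip v u) = a u.
  by apply: eq_bigr => S SB; rewrite chi_flip ?vS.
have fb u : b (flip v u) = b u.
  by apply: eq_bigr => S SB; rewrite chi_flip ?vS.
rewrite (mean_symmetrize v).
apply: (@le_trans _ _ (mean (fun u => (a u ^+ 2 + K * b u ^+ 2) ^+ p))).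
  apply: ler_mean => u; rewrite fa fb sgn_flip mulNr.
  have -> : b u ^+ 2 = (sgn u v * b u) ^+ 2 by rewrite exprMn sgn_sqr mul1r.
  exact: two_point.
rewrite big_subset_setU1//.
apply: minkowski => [u|u| | | |].
- exact: sqr_ge0.
- by rewrite mulr_ge0 ?sqr_ge0.
- by apply: sumr_ge0 => S _; rewrite mulr_ge0 ?sqr_ge0 ?exprn_ge0.
- by apply: sumr_ge0 => S _; rewrite mulr_ge0 ?sqr_ge0 ?exprn_ge0.
- by under eq_mean do rewrite -exprM; apply: IH.
under eq_mean do rewrite exprMn -exprM; rewrite meanZ.
have -> : \sum_(S : {set V} | S \subset B) K ^+ #|v |: S| * c (v |: S) ^+ 2
    = K * \sum_(S : {set V} | S \subset B) K ^+ #|S| * c (v |: S) ^+ 2.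
  rewrite mulr_sumr; apply: eq_bigr => S SB.
  by rewrite cardsU1 vS// add1n exprS mulrA.
rewrite exprMn ler_wpM2l ?exprn_ge0//.
exact: (IH B cB (fun S => c (v |: S))).
Qed.

End Cube.

(** * Tail bounds for Rademacher chaoses *)

Section Tails.
Context (R : realFieldType) (V : finType).
Implicit Types (u : {ffun V -> bool}) (g : {ffun V -> bool} -> R).

Definition prob (Q : pred {ffun V -> bool}) : R := mean (fun u => (Q u)%:R).

Lemma prob_sub (Q Q' : pred {ffun V -> bool}) :
  (forall u, Q u -> Q' u) -> prob Q <= prob Q'.
Proof.
move=> QQ'; apply: ler_mean => u; rewrite ler_nat.
by case: (Q u) (QQ' u) => // ->.
Qed.

Lemma prob_ge0 (Q : pred {ffun V -> bool}) : 0 <= prob Q.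
Proof. by apply: mean_ge0 => u; rewrite ler0n. Qed.

Lemma prob_le1 (Q : pred {ffun V -> bool}) : prob Q <= 1.
Proof. by rewrite -[leRHS](mean_cst V); apply: ler_mean => u; case: (Q u). Qed.

Lemma probU (Q Q' : pred {ffun V -> bool}) :
  prob (fun u => Q u || Q' u) <= prob Q + prob Q'.
Proof.
rewrite -meanD; apply: ler_mean => u; rewrite -natrD ler_nat.
by case: (Q u); case: (Q' u).
Qed.

Lemma prob_exists (I : finType) (P : pred I) (Q : I -> pred {ffun V -> bool}) :
  prob (fun u => [exists i, P i && Q i u]) <= \sum_(i | P i) prob (Q i).
Proof.
rewrite -mean_sum; apply: ler_mean => u.
case: existsP => [[i /andP[Pi Qi]]|_] /=; last first.
  by apply: sumr_ge0 => i _; rewrite ler0n.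
by rewrite (bigD1 i)//= Qi lerDl sumr_ge0// => j _; rewrite ler0n.
Qed.

Lemma markov_moment g (A t : R) (p : nat) : 0 < t ->
  mean (fun u => g u ^+ (2 * p)) <= A ^+ p ->
  prob (fun u => t <= g u ^+ 2) <= (A / t) ^+ p.
Proof.
move=> t0 gA.
rewrite expr_div_n ler_pdivlMr ?exprn_gt0// mulrC (le_trans _ gA)//.
rewrite -meanZ; apply: ler_mean => u.
case: (boolP (t <= _)) => [tg|_]; last first.
  by rewrite mulr0 exprM exprn_ge0 ?sqr_ge0.
by rewrite mulr1 exprM lerXn2r// nnegrE ?sqr_ge0// ltW.
Qed.

(** Distinct indices may carry the same monomial, so the coefficients are
    collected monomial by monomial first. For the squared norm of the linear
    coefficients these collected sums are the inner sums of Gamma. *)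
Lemma chaos_moment (J : finType) (P : pred J) (w : J -> R) (m : J -> {set V})
    (D p : nat) (K : R) :
  (4 * p)%:R <= K -> 1 <= K -> (forall j, P j -> (#|m j| <= D)%N) ->
  mean (fun u => (\sum_(j | P j) w j * chi R (m j) u) ^+ (2 * p)) <=
  (K ^+ D * \sum_(S : {set V}) (\sum_(j | P j && (m j == S)) w j) ^+ 2) ^+ p.
Proof.
move=> pK K1 mD; pose c (S : {set V}) := \sum_(j | P j && (m j == S)) w j.
have K0 : 0 <= K by apply: le_trans K1.
under eq_mean => u.
  rewrite (_ : \sum_(j | P j) _ = \sum_(S : {set V}) c S * chi R S u).
    over.
  rewrite (partition_big m predT)//=; apply: eq_bigr => S _.
  rewrite mulr_suml; apply: eq_bigr => j /andP[_ /eqP ->]; exact.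
apply: le_trans (hypercontractivity _ pK) _.
apply: lerXn2r; rewrite ?nnegrE.
- by apply: sumr_ge0 => S _; rewrite mulr_ge0 ?sqr_ge0 ?exprn_ge0.
- by rewrite mulr_ge0 ?exprn_ge0 ?sumr_ge0// => S _; rewrite sqr_ge0.
rewrite mulr_sumr; apply: ler_sum => S _.
have [|SD] := leqP #|S| D.
  by move=> SD; rewrite ler_wpM2r ?sqr_ge0// ler_weXn2l.
rewrite /c big_pred0 ?expr0n ?mulr0// => j; apply/negP => /andP[Pj /eqP jS].
by move: SD; rewrite -jS ltnNge mD.
Qed.

(** The moment bound and Markov's inequality. The strict inequality in the
    event makes it empty when all the coefficients vanish. *)
Lemma multilinear_tail (J : finType) (P : pred J) (w : J -> R)
    (m : J -> {set V}) (D p : nat) (K L : R) :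
  (4 * p)%:R <= K -> 1 <= K -> 0 < L ->
  (forall j, P j -> (#|m j| <= D)%N) -> {in P &, injective m} ->
  prob (fun u => L * \sum_(j | P j) w j ^+ 2 <
                 (\sum_(j | P j) w j * chi R (m j) u) ^+ 2) <=
  (K ^+ D / L) ^+ p.
Proof.
move=> pK K1 L0 mD mi; set N := \sum_(j | P j) w j ^+ 2.
have N0 : 0 <= N by apply: sumr_ge0 => j _; rewrite sqr_ge0.
have [N00|Npos] := eqVneq N 0.
  rewrite [leLHS](_ : _ = 0).
    by rewrite exprn_ge0// divr_ge0 ?exprn_ge0 ?ltW// (lt_le_trans ltr01).
  rewrite -[RHS](mean_cst V); apply: eq_mean => u.
  have w0 j : P j -> w j = 0.
    move=> Pj; have /psumr_eq0P := N00.
    move=> /(_ (fun j _ => sqr_ge0 (w j)))/(_ j Pj)/eqP.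
    by rewrite sqrf_eq0 => /eqP.
  rewrite big1 => [|j Pj]; last by rewrite w0// mul0r.
  by rewrite expr0n N00 mulr0 ltxx.
have {N0}Npos : 0 < N by rewrite lt_neqAle eq_sym Npos.
apply: (le_trans (@prob_sub _ (fun u =>
    L * N <= (\sum_(j | P j) w j * chi R (m j) u) ^+ 2) _)).
  by move=> u /ltW.
rewrite [K ^+ D / L](_ : _ = (K ^+ D * N) / (L * N)); last first.
  by rewrite -mulf_div divff ?mulr1// gt_eqF.
apply: markov_moment; first exact: mulr_gt0.
apply: le_trans (chaos_moment _ pK K1 mD) _.
rewrite (_ : \sum_S _ = N)// /N [RHS](partition_big m predT)//=.
apply: eq_bigr => S _.
have [j0 /andP[Pj0 /eqP mS]|none] := pickP (fun j => P j && (m j == S)).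
  have E j : (P j && (m j == S)) = (j == j0).
    apply/andP/eqP => [[Pj /eqP jS]|->]; last by rewrite Pj0 mS.
    by apply: mi => //; rewrite jS.
  by rewrite !(eq_bigl _ _ E) !big_pred1_eq.
by rewrite !big_pred0// expr0n.
Qed.

End Tails.

(** * A small ball estimate for linear forms *)

Lemma sin_mean_value (R : realType) (x : R) : 0 <= x ->
  exists2 c, 0 <= c <= x & sin x = cos c * x.
Proof.
move=> x0.
have [|c cx] := @MVT_segment R sin cos 0 x x0 (fun y _ => is_derive_sin y).
  by apply: continuous_subspaceT; exact: continuous_sin.
by rewrite sin0 !subr0 => sc; exists c.
Qed.

Lemma sqr_sin_le (R : realType) (x : R) : sin x ^+ 2 <= x ^+ 2.
Proof.
wlog x0 : x / 0 <= x => [H|].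
  have [|/ltW x0] := leP 0 x; first exact: H.
  by have := H (- x); rewrite sinN !sqrrN oppr_ge0; apply.
have [c _ ->] := sin_mean_value x0.
by rewrite exprMn ler_piMl ?sqr_ge0.
Qed.

Lemma cos_half (R : realType) (x : R) : cos x = 1 - sin (x / 2) ^+ 2 *+ 2.
Proof.
rewrite [in LHS](splitr x) -mulr2n cos_mulr2n cos2sin2.
by rewrite mulrnBl; ring.
Qed.

Lemma cos_ge (R : realType) (x : R) : 1 - x ^+ 2 / 2 <= cos x.
Proof.
by rewrite cos_half; have := sqr_sin_le (x / 2); rewrite expr_div_n; lra.
Qed.

Lemma sin_ge_half (R : realType) (x : R) : 0 <= x <= 1 -> x / 2 <= sin x.
Proof.
move=> /andP[x0 x1].
have [c /andP[c0 cx] ->] := sin_mean_value x0.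
rewrite mulrC ler_wpM2r//.
apply: le_trans (cos_ge c).
have : c ^+ 2 <= 1 by rewrite expr_le1// (le_trans cx).
lra.
Qed.

Lemma norm_cos_le (R : realType) (x : R) : `|x| <= 1 ->
  `|cos x| <= (1 + x ^+ 2 / 8)^-1.
Proof.
move=> x1; have x21 : x ^+ 2 <= 1 by rewrite -real_normK ?num_real// expr_le1.
have x20 := sqr_ge0 x.
rewrite ger0_norm; last by apply: le_trans (cos_ge x); lra.
have c8 : cos x <= 1 - x ^+ 2 / 8.
  rewrite cos_half.
  have h : 0 <= `|x| / 2 <= 1 by rewrite divr_ge0//=; lra.
  have := sin_ge_half h; have [h0 _] := andP h => hs.
  have : (`|x| / 2 / 2) ^+ 2 <= sin (`|x| / 2) ^+ 2.
    by rewrite lerXn2r// ?nnegrE ?divr_ge0// (le_trans _ hs)// divr_ge0.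
  have -> : sin (`|x| / 2) ^+ 2 = sin (x / 2) ^+ 2.
    by have [_|_] := ger0P x => //; rewrite mulNr sinN sqrrN.
  by rewrite !expr_div_n real_normK ?num_real//; lra.
rewrite -[leRHS]mul1r ler_pdivlMr; last by lra.
apply: (@le_trans _ _ ((1 - x ^+ 2 / 8) * (1 + x ^+ 2 / 8))).
  by rewrite ler_wpM2r//; lra.
by rewrite -subr_sqr expr1n gerBl sqr_ge0.
Qed.

(** The inverse of 1 + x ^ 2 / 8 serves here in place of a Gaussian: products
    of such factors are again bounded by a factor of the same form, and its
    sum over the integers is bounded by telescoping. *)
Lemma prod_norm_cos_le (R : realType) (I : Type) (s : seq I) (x : I -> R) :
  (forall i, `|x i| <= 1) ->
  \prod_(i <- s) `|cos (x i)| <= (1 + (\sum_(i <- s) x i ^+ 2) / 8)^-1.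
Proof.
move=> x1; elim: s => [|i s IH]; first by rewrite !big_nil mul0r addr0 invr1.
rewrite !big_cons; set S := \sum_(_ <- _) _ in IH *.
have S0 : 0 <= S by apply: sumr_ge0 => j _; rewrite sqr_ge0.
apply: (@le_trans _ _ ((1 + x i ^+ 2 / 8)^-1 * (1 + S / 8)^-1)).
  by apply: ler_pM => //; [apply: prodr_ge0|apply: norm_cos_le].
have := sqr_ge0 (x i) => xi0.
rewrite -invfM lef_pV2 ?posrE; [|nra|nra]. 
by have := mulr_ge0 S0 xi0; nra.
Qed.

Section SmallBall.
Context (R : realType) (V : finType).
Implicit Types (u : {ffun V -> bool}) (w y : {ffun V -> bool} -> R).

(** The characteristic function of a Rademacher sum, conditionally on the
    signs outside s, on which w, y and b may depend. Averaging the sign of v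
    turns cos (z + b v) and cos (z - b v) into cos z * cos (b v), and then
    cos (b v) joins the weight w. *)
Lemma mean_cos_linear (s : seq V) (b : V -> {ffun V -> bool} -> R) w y :
  uniq s ->
  (forall v u, v \in s -> w (flip v u) = w u) ->
  (forall v u, v \in s -> y (flip v u) = y u) ->
  (forall v v' u, v \in s -> b v' (flip v u) = b v' u) ->
  mean (fun u => w u * cos (y u + \sum_(v <- s) b v u * sgn R u v)) =
  mean (fun u => w u * cos (y u) * \prod_(v <- s) cos (b v u)).
Proof.
elim: s w => [|v s IH] w /=.
  move=> _ _ _ _; apply: eq_mean => u.
  by rewrite !big_nil addr0 mulr1.
move=> /andP[vs us] hw hy hb.
rewrite (mean_symmetrize v).
transitivity (mean (fun u => (w u * cos (b v u)) *
    cos (y u + \sum_(v' <- s) b v' u * sgn R u v'))).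
  apply: eq_mean => u.
  rewrite !big_cons hw ?inE ?eqxx// hy ?inE ?eqxx// hb ?inE ?eqxx// sgn_flip.
  have -> : \sum_(v' <- s) b v' (flip v u) * sgn R (flip v u) v' =
      \sum_(v' <- s) b v' u * sgn R u v'.
    apply: eq_big_seq => v' v's; rewrite hb ?inE ?eqxx// sgn_flip_neq//.
    by apply: contraNneq vs => <-.
  set S := \sum_(_ <- _) _.
  have -> : cos (b v u) = cos (b v u * sgn R u v).
    by rewrite /sgn; case: (u v); rewrite ?expr0 ?expr1 ?mulr1 ?mulrN1 ?cosN.
  set z := b v u * sgn R u v; rewrite mulrN -/z.
  have -> : y u + (z + S) = (y u + S) + z by ring.
  have -> : y u + (- z + S) = (y u + S) - z by ring.
  by rewrite cosD cosB; field.
rewrite IH//.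
- by apply: eq_mean => u; rewrite !big_cons; ring.
- by move=> v' u v's; rewrite hw ?hb// inE v's orbT.
- by move=> v' u v's; rewrite hy// inE v's orbT.
- by move=> v' v'' u v's; rewrite hb// inE v's orbT.
Qed.

End SmallBall.

(** The Fejer kernel, as the squared modulus of a geometric sum: it is
    nonnegative, and it is a combination of characters with nonnegative
    coefficients. *)
Lemma fejer_kernel (R : realType) (N : nat) (x : R) :
  \sum_(k < N) \sum_(l < N) cos ((k%:R - l%:R) * x) =
  (\sum_(k < N) cos (k%:R * x)) ^+ 2 + (\sum_(k < N) sin (k%:R * x)) ^+ 2.
Proof.
rewrite !expr2 !big_distrlr -big_split; apply: eq_bigr => k _ /=.
by rewrite -big_split; apply: eq_bigr => l _; rewrite mulrBl cosB.
Qed.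

Lemma fejer_kernel_ge (R : realType) (N : nat) (x : R) : N%:R * `|x| <= 1 ->
  N%:R ^+ 2 / 4 <= \sum_(k < N) \sum_(l < N) cos ((k%:R - l%:R) * x).
Proof.
move=> Nx; rewrite fejer_kernel.
have H : N%:R / 2 <= \sum_(k < N) cos (k%:R * x).
  rewrite -[N in leLHS]card_ord -mulr_natl mulr1 -[leLHS]mulrC mulr_natr.
  rewrite -sumr_const.
  apply: ler_sum => k _; apply: le_trans (cos_ge _).
  suff : (k%:R * x) ^+ 2 <= 1 by lra.
  rewrite -real_normK ?num_real// expr_le1// normrM normr_nat.
  by apply: le_trans Nx; rewrite ler_wpM2r// ler_nat ltnW.
apply: (@le_trans _ _ ((\sum_(k < N) cos (k%:R * x)) ^+ 2)).
  have -> : N%:R ^+ 2 / 4 = (N%:R / 2) ^+ 2 :> R by field.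
  by rewrite lerXn2r// ?nnegrE ?divr_ge0// (le_trans _ H)// divr_ge0.
by rewrite lerDl sqr_ge0.
Qed.

(** By telescoping: each term is at most 256 / ((k + 1) (k + 2)). *)
Lemma sum_decay (R : realFieldType) (m : nat) :
  \sum_(0 <= k < m) (1 + k%:R ^+ 2 / 64)^-1 <= 256 :> R.
Proof.
suff H : \sum_(0 <= k < m) (1 + k%:R ^+ 2 / 64)^-1 <= 256 - 256 / m.+1%:R :> R.
  by apply: le_trans H _; rewrite gerBl divr_ge0.
elim: m => [|m IH]; first by rewrite big_nil divr1 subrr.
rewrite big_nat_recr//=; apply: le_trans (lerD IH (lexx _)) _.
rewrite -[m.+2]addn1 -[m.+1]addn1 !natrD.
set x := m%:R; have x0 : 0 <= x :> R by rewrite ler0n.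
clearbody x.
rewrite -subr_ge0.
rewrite [leRHS](_ : _ = (256 * (1 + x ^+ 2 / 64) - (x + 1) * (x + 2)) /
  ((x + 1) * (x + 2) * (1 + x ^+ 2 / 64))); last first.
  by field; rewrite !gt_eqF//; nra.
rewrite divr_ge0//; nra.
Qed.

Lemma sum_decay_row (R : realFieldType) (N : nat) (k : 'I_N) :
  \sum_(l < N) (1 + (k%:R - l%:R) ^+ 2 / 64)^-1 <= 512 :> R.
Proof.
pose psi (x : R) := (1 + x ^+ 2 / 64)^-1.
have psi0 x : 0 <= psi x by rewrite invr_ge0 addr_ge0// divr_ge0 ?sqr_ge0.
rewrite -(big_mkord predT (fun l => psi (k%:R - l%:R))).
rewrite (@big_cat_nat _ _ _ k.+1)//=.
have -> : 512 = 256 + 256 :> R by rewrite -natrD.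
apply: lerD; last first.
  apply: le_trans (sum_decay R N).
  rewrite -[k.+1]add0n big_addn.
  apply: (@le_trans _ _ (\sum_(0 <= i < N - k.+1) psi (i.+1%:R))).
    apply: ler_sum => i _; rewrite le_eqVlt; apply/orP; left; apply/eqP.
    rewrite /psi; congr (_ + _ / _)^-1.
    by rewrite natrD -[i.+1]addn1 -[k.+1]addn1 !natrD; ring.
  have kN : (N - k.+1 < N)%N by have := ltn_ord k; lia.
  apply: (@le_trans _ _ (\sum_(0 <= i < (N - k.+1).+1) psi i%:R)).
    by rewrite big_nat_recl//= lerDr.
  rewrite [leRHS](@big_cat_nat _ _ _ (N - k.+1).+1)//= lerDl.
  exact: sumr_ge0.
rewrite big_nat_rev /= add0n.
rewrite (eq_big_nat _ _ (F2 := fun l => psi l%:R)); first exact: sum_decay.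
move=> i /andP[_ ik]; congr psi; rewrite subSS natrB//; ring.
Qed.

(** Esseen's argument with a discrete kernel in place of an integral. With
    frequencies that are multiples of 1 / (2 F) below N / (2 F), where N is
    about F / t, the Fejer kernel is at least of order one on the interval of
    radius t, while its mean is an average of characteristic functions of the
    linear form. On good configurations no coefficient exceeds t, so each
    cosine is in the range where norm_cos_le applies, and the square sum of
    the coefficients makes the product decay in the frequency. The average of
    N ^ 2 terms that decay in k - l is of order 1 / N, that is t / F. *)
Lemma small_ball (R : realType) (V : finType) (s : seq V)
    (a : V -> {ffun V -> bool} -> R) (good : pred {ffun V -> bool})
    (x t F : R) :
  uniq s -> 0 < t -> 0 < F ->
  (forall v u, v \in s -> good (flip v u) = good u) ->
  (forall v v' u, v \in s -> a v' (flip v u) = a v' u) ->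
  (forall v u, good u -> `|a v u| <= t) ->
  (forall u, good u -> F ^+ 2 / 2 <= \sum_(v <- s) a v u ^+ 2) ->
  prob R (fun u => good u && (`|\sum_(v <- s) a v u * sgn R u v - x| <= t))
    <= 2048 * (t / F).
Proof.
move=> us t0 F0 gflip aflip at_ aF.
have [Ft|/ltW tF] := leP F t.
  apply: le_trans (prob_le1 _ _) _.
  have : 1 <= t / F by rewrite ler_pdivlMr// mul1r.
  lra.
pose N := (Num.truncn (F / t)).+1.
have FN : F / t <= N%:R by apply: ltW; exact: truncnS_gt.
have NF : N%:R * t <= 2 * F.
  rewrite /N -[(Num.truncn _).+1]addn1 natrD mulrDl mul1r.
  have : (Num.truncn (F / t))%:R <= F / t by rewrite truncn_le divr_ge0// ltW.
  by rewrite ler_pdivlMr//; lra.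
have N0 : 0 < N%:R :> R by rewrite ltr0n.
pose g u := \sum_(v <- s) a v u * sgn R u v.
(* The multiples of lam below N keep every argument of a cosine in [-1, 1],
   because N * t <= F + t <= 2 * F. *)
pose lam := (2 * F)^-1.
have lam0 : 0 < lam by rewrite invr_gt0 mulr_gt0.
have Nlt : N%:R * (lam * t) <= 1.
  by rewrite mulrCA /lam mulrC ler_pdivrMr ?mul1r// mulr_gt0.
pose c (k l : 'I_N) : R := k%:R - l%:R.
have cN k l : `|c k l| <= N%:R.
  rewrite /c ler_norml; have := ltnW (ltn_ord k); have := ltnW (ltn_ord l).
  rewrite -(ler_nat R) -[(k <= N)%N](ler_nat R).
  by have := ler0n R k; have := ler0n R l; lra.
have phi k l : mean (fun u => (good u)%:R * cos (c k l * (lam * (g u - x))))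
    <= (1 + c k l ^+ 2 / 64)^-1.
  pose th := c k l * lam.
  under eq_mean => u.
    rewrite (_ : c k l * _ =
        - (th * x) + \sum_(v <- s) (th * a v u) * sgn R u v).
      over.
    rewrite (eq_bigr (fun v => th * (a v u * sgn R u v))); last first.
      by move=> v _; rewrite mulrA.
    rewrite -mulr_sumr /th /g; ring.
  rewrite (@mean_cos_linear _ _ _ (fun v u => th * a v u)
    (fun u => (good u)%:R) (fun=> - (th * x)))//; last 2 first.
  - by move=> v u vs; rewrite gflip.
  - by move=> v v' u vs; rewrite aflip.
  have B0 : 0 <= (1 + c k l ^+ 2 / 64)^-1.
    by rewrite invr_ge0 addr_ge0// divr_ge0 ?sqr_ge0.
  rewrite -[leRHS](mean_cst V); apply: ler_mean => u.
  case: (boolP (good u)) => [gu|_]; last by rewrite !mul0r.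
  rewrite mul1r; apply: le_trans (ler_norm _) _; rewrite normrM.
  apply: (@le_trans _ _ (1 * \prod_(v <- s) `|cos (th * a v u)|)).
    by rewrite ler_pM ?cos_max// normr_prod.
  rewrite mul1r; apply: le_trans (prod_norm_cos_le _ _) _ => [v|].
    rewrite normrM /th normrM (gtr0_norm lam0); apply: le_trans Nlt.
    rewrite mulrA ler_pM// ?mulr_ge0 ?ler_wpM2r//;
      [exact: ltW|exact: ltW|exact: at_].
  rewrite lef_pV2 ?posrE; last 2 first.
  - by rewrite ltr_wpDr// divr_ge0// sumr_ge0// => v _; rewrite sqr_ge0.
  - by rewrite ltr_wpDr// divr_ge0// sqr_ge0.
  rewrite lerD2l.
  have -> : c k l ^+ 2 / 64 = (th ^+ 2 * (F ^+ 2 / 2)) / 8.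
    by rewrite /th /lam; field; rewrite gt_eqF.
  rewrite ler_wpM2r//.
  under eq_bigr do rewrite exprMn.
  by rewrite -mulr_sumr ler_wpM2l ?sqr_ge0// aF.
have ker u : (good u && (`|g u - x| <= t))%:R <= 4 / N%:R ^+ 2 *
    \sum_(k < N) \sum_(l < N) (good u)%:R * cos (c k l * (lam * (g u - x))).
  under eq_bigr do rewrite -mulr_sumr.
  rewrite -mulr_sumr; case: (good u) => /=; last by rewrite mul0r mulr0.
  rewrite mul1r; have [gt|_] := leP `|g u - x| t; last first.
    rewrite mulr_ge0 ?divr_ge0 ?sqr_ge0//.
    by rewrite /c fejer_kernel addr_ge0 ?sqr_ge0.
  rewrite [leLHS](_ : _ = 4 / N%:R ^+ 2 * (N%:R ^+ 2 / 4)); last first.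
    by rewrite mulr1n; field; rewrite gt_eqF.
  rewrite ler_wpM2l ?divr_ge0 ?sqr_ge0//.
  apply: fejer_kernel_ge; apply: le_trans Nlt.
  by rewrite ler_wpM2l ?(ltW N0)// normrM (gtr0_norm lam0) ler_wpM2l// ltW.
apply: le_trans (ler_mean ker) _; rewrite meanZ mean_sum.
apply: (@le_trans _ _ (4 / N%:R ^+ 2 * \sum_(k < N) 512)).
  rewrite ler_wpM2l ?divr_ge0 ?sqr_ge0//; apply: ler_sum => k _.
  rewrite mean_sum; apply: le_trans (sum_decay_row R k).
  by apply: ler_sum => l _; exact: phi.
rewrite sumr_const card_ord -[512 *+ N]mulr_natr.
have -> : 4 / N%:R ^+ 2 * (512 * N%:R) = 2048 / N%:R :> R.
  by field; rewrite gt_eqF.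
have NtF : N%:R^-1 <= t / F.
  by rewrite -[t / F]invf_div lef_pV2 ?posrE// divr_gt0.
by apply: ler_wpM2l NtF; rewrite ler0n.
Qed.

(** * Slices of a multilinear form *)

Section Slices.
Context (R : realType) (d n : nat) (f : tensor R 'I_d n).
Local Notation vertex := ('I_d * 'I_n)%type.
Local Notation index := {ffun 'I_d -> 'I_n}.
Implicit Types (I : {set 'I_d}) (i e : index) (u : {ffun vertex -> bool}).

Definition form u : R := \sum_i f i * \prod_k sgn R u (k, i k).

Definition monomial I i : {set vertex} := [set (k, i k) | k in ~: I].

(** Restrictions are indexed by full indices e instead of functions on I, to
    avoid dependent types: the value of e off I is normalized to j0. An index
    i extends the partial index given by e exactly when
    slice_rep j0 I i = e. *)
Definition slice_rep (j0 : 'I_n) I i : index :=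
  [ffun k => if k \in I then i k else j0].

(** The polynomial of the restriction of f given by the values of e on I. *)
Definition slice j0 I e u : R :=
  \sum_(i | slice_rep j0 I i == e) f i * chi R (monomial I i) u.

Lemma chi_monomial I i u :
  chi R (monomial I i) u = \prod_(k | k \notin I) sgn R u (k, i k).
Proof.
rewrite /chi /monomial big_imset /=; last by move=> k l _ _ [].
by apply: eq_bigl => k; rewrite finset.in_setC.
Qed.

Lemma card_monomial I i : #|monomial I i| = (d - #|I|)%N.
Proof.
rewrite card_imset; last by move=> k l [].
by rewrite [LHS]cardsCs finset.setCK card_ord.
Qed.

Lemma monomial_inj j0 I e :
  {in [pred i | slice_rep j0 I i == e] &, injective (monomial I)}.
Proof.
move=> i i' /eqP ie /eqP ie' mii; apply/ffunP => k.
have [kI|kI] := boolP (k \in I).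
  have := congr1 (fun g : index => g k) (etrans ie (esym ie')).
  by rewrite !ffunE kI.
have : (k, i k) \in monomial I i' by rewrite -mii imset_f// finset.in_setC.
by case/imsetP => l _ [-> ->].
Qed.

Lemma sum_norm_sgnB k u u' :
  \sum_(j < n) `|sgn R u' (k, j) - sgn R u (k, j)|
    <= 2 * #|[set v | u v != u' v]|%:R.
Proof.
apply: (@le_trans _ _ (\sum_(j < n) 2 * (u (k, j) != u' (k, j))%:R)).
  apply: ler_sum => j _; rewrite /sgn.
  case: (u (k, j)); case: (u' (k, j));
    rewrite ?expr0 ?expr1 ?subrr ?normr0 ?mulr0//=.
    by rewrite opprK ger0_norm// mulr1.
  by rewrite -opprD normrN ger0_norm// mulr1.
rewrite -mulr_sumr ler_wpM2l// -natr_sum ler_nat.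
have -> : (\sum_(j < n) (u (k, j) != u' (k, j)) =
    #|[set (k, j) | j in [set j | u (k, j) != u' (k, j)]]|)%N.
  rewrite card_imset => [|j l [] //].
  rewrite -sum1_card [RHS]big_mkcond; apply: eq_bigr => j _.
  by rewrite inE; case: eqP.
by apply/subset_leq_card/fintype.subsetP => _ /imsetP[j + ->]; rewrite !inE.
Qed.

(** Writing each sign of u' as the sign of u plus an increment, the product
    over the modes expands over the set I of the modes that contribute an
    increment. The set I = set0 gives form u. For another I, grouping the
    indices by their values on I leaves the slices of f at u, weighted by
    products of increments; the absolute values of the increments in one mode
    add up to at most 2 r, so these weights add up to at most (2 r) ^ #|I|. *)
Lemma form_perturbation j0 (M : {set 'I_d} -> R) (r : nat) u u' :
  (forall I e, I != finset.set0 -> `|slice j0 I e u| <= M I) ->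
  (#|[set v | u v != u' v]| <= r)%N ->
  `|form u' - form u| <=
    \sum_(I : {set 'I_d} | I != finset.set0) (2 * r%:R) ^+ #|I| * M I.
Proof.
move=> sM ur; pose del k j := sgn R u' (k, j) - sgn R u (k, j).
pose T I := \sum_i f i *
  \prod_k (if k \in I then del k (i k) else sgn R u (k, i k)).
have -> : form u' = \sum_I T I.
  rewrite exchange_big; apply: eq_bigr => i _ /=.
  rewrite -mulr_sumr -(bigA_distr 1 _ (fun k => del k (i k))); congr (_ * _).
  by apply: eq_bigr => k _; rewrite /= /del subrK.
have T0 : T finset.set0 = form u.
  by apply: eq_bigr => i _; congr (_ * _); apply: eq_bigr => k _; rewrite inE.
rewrite (bigD1 finset.set0)//= T0 [form u + _]addrC addrK.
apply: le_trans (ler_norm_sum _ _ _) _; apply: ler_sum => I I0.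
have M0 : 0 <= M I by apply: le_trans (sM I [ffun=> j0] I0).
have -> : T I = \sum_(e in pffun_on j0 (mem I) predT)
    (\prod_(k in I) del k (e k)) * slice j0 I e u.
  rewrite /T (partition_big (slice_rep j0 I)
    (mem (pffun_on j0 (mem I) predT)))/=; last first.
    move=> i _; apply/pffun_onP; split=> //.
    apply/fintype.subsetP => k; rewrite !inE ffunE.
    by case: ifP => //; rewrite eqxx.
  apply: eq_bigr => e _; rewrite mulr_sumr; apply: eq_bigr => i /eqP <-.
  rewrite mulrCA; congr (_ * _).
  rewrite (bigID (mem I))/= chi_monomial; congr (_ * _).
    by apply: eq_bigr => k kI; rewrite kI ffunE kI.
  by apply: eq_bigr => k /negPf ->.
apply: le_trans (ler_norm_sum _ _ _) _.
apply: (@le_trans _ _ (\sum_(e in pffun_on j0 (mem I) predT)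
    (\prod_(k in I) `|del k (e k)|) * M I)).
  by apply: ler_sum => e _; rewrite normrM normr_prod ler_wpM2l ?prodr_ge0// sM.
rewrite -mulr_suml -(big_distr_big j0 (mem I) predT (fun k j => `|del k j|)).
rewrite ler_wpM2r// -prodr_const; apply: ler_prod => k _.
rewrite sumr_ge0//=; apply: le_trans (sum_norm_sgnB _ _ _) _.
by rewrite ler_wpM2l// ler_nat.
Qed.

End Slices.

(** * The linear coefficients along one mode *)

Section Coefficients.
Context (R : realType) (d n : nat) (f : tensor R 'I_d n).
Local Notation vertex := ('I_d * 'I_n)%type.
Local Notation index := {ffun 'I_d -> 'I_n}.
Local Notation coindex := {ffun 'I_d.-1 -> 'I_n}.
Implicit Types (I : {set 'I_d}) (j : 'I_n) (i e : index).
Implicit Types (u : {ffun vertex -> bool}).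

Lemma sqr_frobenius (D : finType) (g : tensor R D n) :
  frobenius g ^+ 2 = \sum_i g i ^+ 2.
Proof. by rewrite sqr_sqrtr// sumr_ge0// => i _; rewrite sqr_ge0. Qed.

Lemma slice_norm_le j0 I e :
  \sum_(i | slice_rep j0 I i == e) f i ^+ 2 <=
  frobenius (restriction f [ffun k : {k : 'I_d | k \in I} => e (val k)]) ^+ 2.
Proof.
set dI := [ffun _ => _]; rewrite sqr_frobenius.
pose g i := [ffun k : {k : 'I_d | k \notin I} => i (val k)].
rewrite (reindex_onto (merge_index dI) g) /=; last first.
  move=> i /eqP ie; apply/ffunP => k; rewrite ffunE.
  (* The branches of the match use the case they are in, so the match has to
     be opened without abstracting k \in I. *)
  refine (match boolP (k \in I) as a in alt_spec _ _ _ return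
    match a with
    | AltTrue kI => dI (exist _ k kI) | AltFalse kI => g i (exist _ k kI)
    end = i k with AltTrue kI => _ | AltFalse kI => _ end); rewrite ffunE//=.
  by rewrite -ie ffunE kI.
rewrite big_mkcond /=; apply: ler_sum => l _; rewrite ffunE.
by case: ifP => // _; rewrite sqr_ge0.
Qed.

(** A union bound over the 2 ^ d * n ^ d pairs of I and e. Each slice is a
    chaos of degree at most d - 1, because at least one mode is fixed. *)
Lemma slices_tail j0 (p : nat) (K L : R) :
  (4 * p)%:R <= K -> 1 <= K -> 0 < L ->
  prob R (fun u => [exists x : {set 'I_d} * index, (x.1 != finset.set0) &&
    (L * \sum_(i | slice_rep j0 x.1 i == x.2) f i ^+ 2
       < slice f j0 x.1 x.2 u ^+ 2)])
  <= (2 ^ d * n ^ d)%:R * (K ^+ d.-1 / L) ^+ p.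
Proof.
move=> pK K1 L0; apply: le_trans (prob_exists _ _ _) _.
have -> : (2 ^ d * n ^ d)%N = #|{: {set 'I_d} * index}|.
  rewrite card_prod card_ffun !card_ord -cardsT -finset.powersetT.
  by rewrite card_powerset cardsT card_ord.
rewrite mulr_natl -sumr_const big_mkcond /=; apply: ler_sum => -[I e] _ /=.
case: ifP => [I0|_]; last first.
  by rewrite exprn_ge0// divr_ge0 ?exprn_ge0 ?ltW// (lt_le_trans _ K1).
apply: multilinear_tail => //; last exact: monomial_inj.
move=> i _; rewrite card_monomial.
by move: I0; rewrite -finset.card_gt0; lia.
Qed.

(** As a function of the signs of mode i0, the form is linear; coef i0 j is the
    coefficient of the sign j of that mode. *)
Definition coef (i0 : 'I_d) j u : R :=
  \sum_(i : index | i i0 == j) f i * chi R (monomial [set i0] i) u.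

Lemma slice_rep_single (j0 : 'I_n) (i0 : 'I_d) j i :
  (slice_rep j0 [set i0] i == [ffun k => if k == i0 then j else j0])
  = (i i0 == j).
Proof.
apply/eqP/eqP => [ie|<-].
  by have := congr1 (fun g : index => g i0) ie; rewrite !ffunE inE eqxx.
by apply/ffunP => k; rewrite !ffunE inE; case: eqP => // ->.
Qed.

Lemma coef_slice (j0 : 'I_n) (i0 : 'I_d) j u :
  coef i0 j u = slice f j0 [set i0] [ffun k => if k == i0 then j else j0] u.
Proof. by apply: eq_bigl => i; rewrite slice_rep_single. Qed.

Lemma form_coef (i0 : 'I_d) u : form f u = \sum_j coef i0 j u * sgn R u (i0, j).
Proof.
rewrite /form (partition_big (fun i : index => i i0) predT)//=.
apply: eq_bigr => j _; rewrite mulr_suml; apply: eq_bigr => i /eqP <-.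
rewrite chi_monomial (bigD1 i0)//= -mulrA; congr (_ * _).
rewrite mulrC; congr (_ * _); apply: eq_bigl => k; by rewrite inE.
Qed.

Lemma coef_flip (i0 : 'I_d) j j' u : coef i0 j (flip (i0, j') u) = coef i0 j u.
Proof.
apply: eq_bigr => i _; rewrite chi_flip//.
by apply/imsetP => -[k]; rewrite !inE => ki [/esym kE _]; rewrite kE eqxx in ki.
Qed.

Lemma sum_insert (i0 : 'I_d) j (G : index -> R) :
  \sum_(i : index | i i0 == j) G i = \sum_(l : coindex) G (insert_index i0 j l).
Proof.
rewrite (reindex_onto (insert_index i0 j)
  (fun i => [ffun s => i (lift i0 s)])) /=; last first.
  move=> i /eqP ij; apply/ffunP => k; rewrite !ffunE.
  by case: unliftP => [s ->|->]; rewrite ?ffunE.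
apply: eq_bigl => l; rewrite ffunE unlift_none eqxx /=.
by apply/eqP/ffunP => s; rewrite !ffunE liftK.
Qed.

Lemma monomial_insert (i0 : 'I_d) j (l : coindex) :
  monomial [set i0] (insert_index i0 j l) = phi i0 l.
Proof.
apply/setP => -[k m]; apply/imsetP/imsetP => [[k']|[s _]].
  rewrite !inE ffunE => k'i [-> ->].
  by case: unliftP k'i => [s ->|->]; rewrite ?eqxx// => _; exists s.
move=> [-> ->]; exists (lift i0 s); last by rewrite ffunE liftK.
by rewrite !inE eq_sym neq_lift.
Qed.

Lemma coef_insert (i0 : 'I_d) j u :
  coef i0 j u = \sum_(l : coindex) f (insert_index i0 j l) * chi R (phi i0 l) u.
Proof.
by rewrite /coef sum_insert; apply: eq_bigr => l _; rewrite monomial_insert.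
Qed.

Lemma gram_entryE (i0 : 'I_d) (l l' : coindex) : gram_entry f i0 l l' =
  \sum_j f (insert_index i0 j l) * f (insert_index i0 j l').
Proof.
by rewrite /gram_entry mxE; apply: eq_bigr => j _; rewrite !mxE !enum_rankK.
Qed.

Definition symdiff (i0 : 'I_d) (q : coindex * coindex) : {set vertex} :=
  (phi i0 q.1 :|: phi i0 q.2) :\: (phi i0 q.1 :&: phi i0 q.2).

Lemma chiM (V : finType) (S T : {set V}) (u : {ffun V -> bool}) :
  chi R S u * chi R T u = chi R ((S :|: T) :\: (S :&: T)) u.
Proof.
rewrite /chi !(big_mkcond (fun v => v \in _)) -big_split.
apply: eq_bigr => v _ /=.
rewrite !inE; case: (v \in S); case: (v \in T); rewrite /= ?mulr1 ?mul1r//.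
by rewrite -expr2 sgn_sqr.
Qed.

(** The diagonal pairs give the constant term, which is the squared Frobenius
    norm; the other pairs give monomials supported on the symmetric
    differences that define Ext. *)
Lemma sum_sqr_coef (i0 : 'I_d) u : \sum_j coef i0 j u ^+ 2 = frobenius f ^+ 2 +
  \sum_(q : coindex * coindex | q.1 != q.2)
    gram_entry f i0 q.1 q.2 * chi R (symdiff i0 q) u.
Proof.
transitivity (\sum_(q : coindex * coindex)
    gram_entry f i0 q.1 q.2 * (chi R (phi i0 q.1) u * chi R (phi i0 q.2) u)).
  under eq_bigr do rewrite coef_insert expr2 big_distrlr /= pair_bigA /=.
  rewrite exchange_big; apply: eq_bigr => q _ /=.
  by rewrite gram_entryE mulr_suml; apply: eq_bigr => j _; rewrite mulrACA.
rewrite (bigID (fun q : coindex * coindex => q.1 == q.2)) /=; congr (_ + _).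
  rewrite -(pair_big_dep predT (fun l l' => l == l') (fun l l' =>
    gram_entry f i0 l l' * (chi R (phi i0 l) u * chi R (phi i0 l') u))) /=.
  rewrite sqr_frobenius (partition_big (fun i : index => i i0) predT)//=.
  under [RHS]eq_bigr do rewrite sum_insert.
  rewrite exchange_big; apply: eq_bigr => l _ /=.
  rewrite (big_pred1 l) => [|l']; last by rewrite eq_sym.
  rewrite chiM finset.setUid finset.setIid finset.setDv /chi big_set0 mulr1.
  rewrite gram_entryE.
  by apply: eq_bigr => j _; rewrite expr2.
by apply: eq_bigr => q _; rewrite chiM.
Qed.

End Coefficients.

(** * The variance of the squared norm of the linear coefficients *)

Section Variance.
Context (R : realType) (d n : nat) (f : tensor R 'I_d n) (i0 : 'I_d).
Local Notation vertex := ('I_d * 'I_n)%type.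
Local Notation coindex := {ffun 'I_d.-1 -> 'I_n}.
Implicit Types (l : coindex) (q : coindex * coindex).

Lemma lift_pair_inj (s s' : 'I_d.-1) (m m' : 'I_n) :
  (lift i0 s, m) = (lift i0 s', m') -> s = s' /\ m = m'.
Proof. by move=> e; have /lift_inj := congr1 fst e; have := congr1 snd e. Qed.

Lemma mem_phi_lift l s m : ((lift i0 s, m) \in phi i0 l) = (m == l s).
Proof.
apply/imsetP/eqP => [[s' _ /lift_pair_inj[-> ->//]]|->]; by exists s.
Qed.

Lemma mem_phi_self l m : ((i0, m) \in phi i0 l) = false.
Proof.
apply/imsetP => -[s _ /(congr1 fst)/eqP/=].
by rewrite (negPf (neq_lift _ _)).
Qed.

Lemma gamma_ik_le k : (1 <= k < (2 * d.-1).+1)%N -> ~~ odd k ->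
  Gamma_ik f i0 k <= Gamma f.
Proof.
move=> kd ko; rewrite /Gamma.
apply: (@le_trans _ _ (\big[Num.max/0]_(1 <= k < (2 * d.-1).+1 | ~~ odd k)
  Gamma_ik f i0 k)); last exact: (le_bigmax _ _ i0).
apply: le_bigmax_seq => //; by rewrite mem_index_iota.
Qed.

Definition disagreement q := enum [set s | q.1 s != q.2 s].

(** The symmetric difference of the two index sets of q, listed in the order
    that Rel asks for: first the entries of q.1, then those of q.2, at the
    positions where they differ. *)
Definition relation_seq q : seq vertex :=
  [seq (lift i0 s, q.1 s) | s <- disagreement q] ++
  [seq (lift i0 s, q.2 s) | s <- disagreement q].

Lemma mem_disagreement q s : (s \in disagreement q) = (q.1 s != q.2 s).
Proof. by rewrite mem_enum inE. Qed.

Lemma mem_lift_map (g : coindex) (t : seq 'I_d.-1) s m :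
  ((lift i0 s, m) \in [seq (lift i0 s, g s) | s <- t])
  = (s \in t) && (m == g s).
Proof.
apply/mapP/andP => [[s' s't /lift_pair_inj[-> ->//]]|[st /eqP ->]]; by exists s.
Qed.

Lemma mem_relation_seq q : relation_seq q =i symdiff i0 q.
Proof.
move=> -[k m]; rewrite mem_cat !inE.
case: (unliftP i0 k) => [s ->|->].
  rewrite !mem_lift_map !mem_phi_lift mem_disagreement.
  have [<-|qs] := eqVneq (q.1 s) (q.2 s); first by case: eqP.
  case: eqP => [->|_] /=; last by rewrite ?andbT.
  by rewrite (negPf qs).
rewrite !mem_phi_self /=.
apply/negP => /orP[] /mapP[s _ /(congr1 fst)/eqP/=];
  by rewrite (negPf (neq_lift _ _)).
Qed.

Lemma relation_seq_uniq q : uniq (relation_seq q).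
Proof.
have lift_map (g : coindex) : injective (fun s => (lift i0 s, g s)).
  by move=> s s' /lift_pair_inj[].
rewrite cat_uniq !map_inj_uniq// enum_uniq andbT /=.
apply/hasPn => _ /mapP[s sq ->]; rewrite mem_lift_map sq /= eq_sym.
by rewrite -mem_disagreement.
Qed.

Lemma card_symdiff q : #|symdiff i0 q| = (2 * size (disagreement q))%N.
Proof.
rewrite -(eq_card (mem_relation_seq q)) (card_uniqP (relation_seq_uniq q)).
by rewrite size_cat !size_map mul2n addnn.
Qed.

Lemma symdiff_range q : q.1 != q.2 ->
  (1 <= #|symdiff i0 q| < (2 * d.-1).+1)%N && ~~ odd #|symdiff i0 q|.
Proof.
move=> qN; rewrite card_symdiff mul2n odd_double andbT -mul2n ltnS leq_mul2l /=.
apply/andP; split; last first.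
  by rewrite -cardE (leq_trans (max_card _))// card_ord.
rewrite muln_gt0 /= lt0n; apply: contraNneq qN => /size0nil q0.
by apply/eqP/ffunP => s; apply/eqP; rewrite -[_ == _]negbK -mem_disagreement q0.
Qed.

Lemma exists_relation q :
  exists2 t, t \in Rel n i0 #|symdiff i0 q| & [set p in t] = symdiff i0 q.
Proof.
have st : size (relation_seq q) == #|symdiff i0 q|.
  by rewrite -(eq_card (mem_relation_seq q)) (card_uniqP (relation_seq_uniq q)).
exists (Tuple st); last by apply/setP => p; rewrite inE mem_relation_seq.
have sd (T : Type) (g : 'I_d.-1 -> T) :
    size [seq g s | s <- disagreement q] == #|symdiff i0 q|./2.
  by rewrite size_map card_symdiff mul2n doubleK.
rewrite inE; apply/existsP; exists (Tuple (sd _ (lift i0))).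
apply/existsP; exists (Tuple (sd _ q.1)).
apply/existsP; exists (Tuple (sd _ q.2)).
apply/and4P; split.
- by rewrite /= !zip_map.
- by apply/mapP => -[s _ /eqP]; rewrite (negPf (neq_lift _ _)).
- by rewrite map_inj_uniq ?enum_uniq//; exact: lift_inj.
apply/forallP => s.
have sD : (s < size (disagreement q))%N.
  by apply: leq_trans (ltn_ord s) _; rewrite card_symdiff mul2n doubleK.
have [s0 _] : exists s0 : 'I_d.-1, s0 \in disagreement q.
  by case: (disagreement q) sD => // s0 t _; exists s0; rewrite mem_head.
rewrite !(tnth_nth (q.1 s0)) /= !(nth_map s0)// -mem_disagreement.
exact: mem_nth.
Qed.

(** Each collected coefficient that is not an empty sum is the sum over Ext of
    some tuple in Rel, by exists_relation. Since Rel contains at least one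
    ordering of every symmetric difference, the coefficients of even degree k
    contribute at most Gamma_ik f i0 k ^ 2, and there are at most 2 d degrees. *)
Lemma symdiff_variance :
  \sum_(S : {set vertex})
    (\sum_(q : coindex * coindex | (q.1 != q.2) && (symdiff i0 q == S))
      gram_entry f i0 q.1 q.2) ^+ 2 <= (2 * d)%:R * Gamma f ^+ 2.
Proof.
pose X (S : {set vertex}) :=
  \sum_(q : coindex * coindex | symdiff i0 q == S) gram_entry f i0 q.1 q.2.
pose realised (S : {set vertex}) :=
  [exists q : coindex * coindex, (q.1 != q.2) && (symdiff i0 q == S)].
have symdiff_card (S : {set vertex}) : realised S ->
    (1 <= #|S| < (2 * d.-1).+1)%N && ~~ odd #|S|.
  by move=> /existsP[q /andP[qN /eqP <-]]; exact: symdiff_range.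
have symdiff_diag l : symdiff i0 (l, l) = finset.set0.
  by rewrite /symdiff finset.setUid finset.setIid finset.setDv.
apply: (@le_trans _ _ (\sum_(S | realised S) X S ^+ 2)).
  rewrite [leRHS]big_mkcond /=; apply: ler_sum => S _.
  case: ifP => [rS|/negbT rS]; last first.
    rewrite big_pred0 ?expr0n// => q; apply: contraNF rS => qS.
    by apply/existsP; exists q.
  rewrite le_eqVlt (eq_bigl (fun q => symdiff i0 q == S)) ?eqxx//.
  move=> -[l l'] /=; have [<-|//] := eqVneq l l'; rewrite symdiff_diag.
  by apply/esym/eqP => S0; move/symdiff_card: rS; rewrite -S0 finset.cards0.
rewrite (partition_big (fun S : {set vertex} => inord #|S| : 'I_(2 * d.-1).+1)
  (fun k => (1 <= k)%N && ~~ odd k)) /=; last first.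
  by move=> S /symdiff_card /andP[/andP[S0 Sd] So]; rewrite inordK// S0.
apply: (@le_trans _ _ (\sum_(k < (2 * d.-1).+1 | (1 <= k)%N && ~~ odd k)
    Gamma f ^+ 2)).
  apply: ler_sum => k /andP[k1 ko].
  have kd : (1 <= k < (2 * d.-1).+1)%N by rewrite k1 ltn_ord.
  apply: (@le_trans _ _ (Gamma_ik f i0 k ^+ 2)); last first.
    by rewrite lerXn2r ?gamma_ik_le// ?nnegrE ?sqrtr_ge0//
      (le_trans _ (gamma_ik_le kd ko))// sqrtr_ge0.
  rewrite sqr_sqrtr; last by apply: sumr_ge0 => t _; rewrite sqr_ge0.
  rewrite [leRHS](partition_big (fun t : k.-tuple vertex => [set p in t])
    predT)//= big_mkcond /=; apply: ler_sum => S _.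
  case: ifP => [/andP[rS /eqP Sk]|_]; last first.
    by apply: sumr_ge0 => t _; rewrite sqr_ge0.
  have {}Sk : #|S| = k.
    by rewrite -Sk inordK//; have /andP[/andP[]] := symdiff_card S rS.
  have [t tR tS] : exists2 t, t \in Rel n i0 k & [set p in t] = S.
    case/existsP: rS => q /andP[_ /eqP qS].
    by have := exists_relation q; rewrite qS Sk.
  rewrite (bigD1 t) /=; last by rewrite tR tS eqxx.
  rewrite -[leLHS]addr0; apply: lerD; last first.
    by apply: sumr_ge0 => t' _; rewrite sqr_ge0.
  rewrite le_eqVlt (_ : X S = \sum_(jk in Ext i0 t) gram_entry f i0 jk.1 jk.2).
    by rewrite eqxx.
  by apply: eq_bigl => q; rewrite inE tS.
rewrite big_mkcond /=.
apply: (@le_trans _ _ (\sum_(k < (2 * d.-1).+1) Gamma f ^+ 2)).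
  by apply: ler_sum => k _; case: ifP => // _; rewrite sqr_ge0.
rewrite sumr_const card_ord -[Gamma f ^+ 2 *+ _]mulr_natl.
rewrite ler_wpM2r ?sqr_ge0// ler_nat.
by have := ltn_ord i0; lia.
Qed.

End Variance.

(** * Resilience under the uniform measure of the cube *)

Section CubeBound.
Context (R : realType) (d n : nat) (f : tensor R 'I_d n) (i0 : 'I_d).
Local Notation vertex := ('I_d * 'I_n)%type.
Local Notation index := {ffun 'I_d -> 'I_n}.
Implicit Types (I : {set 'I_d}) (i e : index) (u : {ffun vertex -> bool}).
Hypothesis F0 : 0 < frobenius f.

Lemma Gamma_ge0 : 0 <= Gamma f.
Proof. exact: bigmax_ge_id. Qed.

(** Markov's inequality for the centred chaos of sum_sqr_coef, of degree at
    most 2 (d - 1), with symdiff_variance as the bound of its variance. *)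
Lemma coef_tail (p : nat) (K : R) : (4 * p)%:R <= K -> 1 <= K ->
  prob R (fun u => \sum_j coef f i0 j u ^+ 2 < frobenius f ^+ 2 / 2) <=
  ((8 * d)%:R * K ^+ (2 * d.-1) * (Gamma f / frobenius f ^+ 2) ^+ 2) ^+ p.
Proof.
move=> pK K1; set F2 := frobenius f ^+ 2.
have F20 : 0 < F2 by rewrite exprn_gt0.
pose coindex := {ffun 'I_d.-1 -> 'I_n}.
pose h u := \sum_(q : coindex * coindex | q.1 != q.2)
  gram_entry f i0 q.1 q.2 * chi R (symdiff i0 q) u.
apply: (@le_trans _ _ (prob R (fun u => F2 ^+ 2 / 4 <= h u ^+ 2))).
  apply: prob_sub => u; rewrite sum_sqr_coef -/F2 -/(h u) => hF.
  have -> : F2 ^+ 2 / 4 = (F2 / 2) ^+ 2 by field.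
  rewrite -[h u ^+ 2]sqrrN lerXn2r ?nnegrE//; lra.
have -> : (8 * d)%:R * K ^+ (2 * d.-1) * (Gamma f / F2) ^+ 2 =
    K ^+ (2 * d.-1) * ((2 * d)%:R * Gamma f ^+ 2) / (F2 ^+ 2 / 4).
  by rewrite !natrM; field; rewrite gt_eqF.
apply: markov_moment; first by rewrite divr_gt0 ?exprn_gt0.
apply: le_trans (chaos_moment (D := 2 * d.-1) _ pK K1 _) _ => [q _|].
  rewrite card_symdiff leq_mul2l /= -cardE.
  by rewrite (leq_trans (max_card _))// card_ord.
have KD : 0 <= K ^+ (2 * d.-1) by rewrite exprn_ge0// (le_trans _ K1).
apply: lerXn2r; rewrite ?nnegrE.
- by rewrite mulr_ge0// sumr_ge0// => S _; rewrite sqr_ge0.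
- by rewrite mulr_ge0// mulr_ge0 ?sqr_ge0.
by rewrite ler_wpM2l// symdiff_variance.
Qed.

Lemma half_le_expR : 2^-1 <= expR (- 2^-1) :> R.
Proof. by apply: le_trans (expR_ge1Dx _); lra. Qed.

(** If Gamma vanishes, so does the variance, and the squared norm of the
    linear coefficients is constant. *)
Lemma coef_tail_gamma0 : Gamma f = 0 ->
  prob R (fun u => \sum_j coef f i0 j u ^+ 2 < frobenius f ^+ 2 / 2) = 0.
Proof.
move=> G0; apply/le_anti; rewrite prob_ge0 andbT.
apply: le_trans (coef_tail (p := 1) (K := 4) _ _) _; [by []|by rewrite ler1n|].
by rewrite G0 mul0r expr0n /= mulr0 expr1.
Qed.

Lemma mul8_le_exp256 (m : nat) : (0 < m)%N -> (16 * m <= 256 ^ m)%N.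
Proof.
elim: m => // -[|m] IH _; first by [].
by rewrite expnS; have := IH isT; lia.
Qed.

(** The moment p is taken of order y ^ (1 / d), where y is the ratio of the
    squared norm and Gamma. Then the base in coef_tail is at most 1 / 2. When
    this p is zero the right-hand side is at least one. *)
Lemma coef_tail_expR : 0 < Gamma f ->
  prob R (fun u => \sum_j coef f i0 j u ^+ 2 < frobenius f ^+ 2 / 2) <=
  expR 1 * expR (- (128^-1 * (frobenius f ^+ 2 / Gamma f) `^ d%:R^-1)).
Proof.
move=> G0; set y := _ / Gamma f; set z := y `^ _.
have d0 : (0 < d)%N by apply: leq_ltn_trans (ltn_ord i0).
have y0 : 0 < y by rewrite divr_gt0// exprn_gt0.
have z0 : 0 <= z by rewrite powR_ge0.
have zd : z ^+ d = y.
  rewrite -powR_mulrn// /z -powRrM mulVf ?powRr1 ?(ltW y0)//.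
  by rewrite pnatr_eq0 -lt0n.
pose p := Num.truncn (z / 64).
have pz : p%:R <= z / 64 by rewrite truncn_le divr_ge0.
have zp : z / 64 < p%:R + 1 by rewrite natr1 truncnS_gt.
rewrite -expRD; have [p0|p0] := posnP p.
  rewrite p0 in zp; apply: le_trans (prob_le1 _ _) _.
  by rewrite -[leLHS]expR0 ler_expR; lra.
have p1 : 1 <= (4 * p)%:R :> R by rewrite ler1n muln_gt0.
apply: le_trans (coef_tail (lexx _) p1) _.
apply: (@le_trans _ _ (2^-1 ^+ p)).
  apply: lerXn2r; rewrite ?nnegrE ?invr_ge0//.
    by rewrite mulr_ge0 ?sqr_ge0// mulr_ge0// exprn_ge0.
  have -> : Gamma f / frobenius f ^+ 2 = y^-1 by rewrite /y invf_div.
  rewrite exprVn ler_pdivrMr ?exprn_gt0//.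
  apply: (@le_trans _ _ ((8 * d)%:R * (4 * p)%:R ^+ (2 * d))).
    by rewrite ler_wpM2l// ler_weXn2l// leq_mul2l leq_pred orbT.
  apply: (@le_trans _ _ ((8 * d)%:R * (z / 16) ^+ (2 * d))).
    rewrite ler_wpM2l// lerXn2r ?nnegrE ?divr_ge0//.
    by rewrite natrM; lra.
  have -> : (z / 16) ^+ (2 * d) = y ^+ 2 / (256 ^ d)%:R.
    rewrite mulnC exprM expr_div_n zd expr_div_n -exprM mulnC exprM natrX.
    by congr (_ / (_ ^+ _)); rewrite -natrX.
  rewrite mulrCA [_ * y ^+ 2]mulrC ler_wpM2l ?sqr_ge0//.
  rewrite ler_pdivrMr ?ltr0n ?expn_gt0//.
  have := mul8_le_exp256 d0; rewrite -(ler_nat R) !natrM; lra.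
apply: (@le_trans _ _ (expR (- 2^-1) ^+ p)).
  by rewrite lerXn2r ?nnegrE ?expR_ge0 ?invr_ge0// half_le_expR.
by rewrite -expRM_natl ler_expR; lra.
Qed.

Definition max_ratio I : R :=
  \big[Num.max/0]_(dI : {ffun {k : 'I_d | k \in I} -> 'I_n})
    (frobenius (restriction f dI) / frobenius f).

Lemma max_ratio_ge0 I : 0 <= max_ratio I.
Proof. exact: bigmax_ge_id. Qed.

Lemma slice_norm_sqr_le j0 I e :
  \sum_(i | slice_rep j0 I i == e) f i ^+ 2 <= (frobenius f * max_ratio I) ^+ 2.
Proof.
apply: le_trans (slice_norm_le f j0 I e) _.
set dI := finfun _.
have fdI : 0 <= frobenius (restriction f dI) by rewrite sqrtr_ge0.
have dM : frobenius (restriction f dI) <= frobenius f * max_ratio I.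
  by rewrite mulrC -ler_pdivrMr//; exact: (le_bigmax _ _ dI).
by rewrite lerXn2r ?nnegrE// (le_trans _ dM).
Qed.

(** The squares of the norms of the n slices along mode i0 add up to the
    squared norm of f, so one of them carries at least a fraction 1 / n of it. *)
Lemma max_ratio_single : 1 <= n%:R * max_ratio [set i0] ^+ 2.
Proof.
have [j0 _|none] := pickP 'I_n; last first.
  have := F0; rewrite /frobenius big1 ?sqrtr0 ?ltxx// => i _.
  by have := none (i i0).
have F20 : 0 < frobenius f ^+ 2 by rewrite exprn_gt0.
rewrite -(ler_pM2r F20) mul1r -mulrA -exprMn sqr_frobenius.
rewrite (partition_big (fun i : index => i i0) predT)//=.
have -> : n%:R = \sum_(j < n) 1 :> R by rewrite sumr_const card_ord.
rewrite mulr_suml; apply: ler_sum => j _.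
rewrite mul1r [_ * frobenius f]mulrC.
apply: le_trans (slice_norm_sqr_le j0 [set i0]
  [ffun k => if k == i0 then j else j0]).
by rewrite (eq_bigl _ _ (slice_rep_single j0 i0 j)).
Qed.

Definition near_level (r : nat) (x : R) u : bool :=
  [exists u' : {ffun vertex -> bool},
     (#|[set v | u v != u' v]| <= r)%N && (form f u' == x)].

Definition ratio_sum (r : nat) : R :=
  \sum_(I : {set 'I_d} | I != finset.set0) r%:R ^+ #|I| * max_ratio I.

Lemma max_ratio_le_sum (r : nat) I : (1 <= r)%N -> I != finset.set0 ->
  max_ratio I <= ratio_sum r.
Proof.
move=> r1 I0; rewrite /ratio_sum (bigD1 I)//=.
apply: (@le_trans _ _ (r%:R ^+ #|I| * max_ratio I)).
  by rewrite ler_peMl ?max_ratio_ge0// exprn_ege1// ler1n.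
rewrite lerDl sumr_ge0// => I' _.
by rewrite mulr_ge0 ?exprn_ge0// max_ratio_ge0.
Qed.

Lemma invn_le_ratio_sum (r : nat) : (1 <= r)%N -> n%:R^-1 <= ratio_sum r.
Proof.
move=> r1; have I0 : [set i0] != finset.set0.
  by apply/finset.set0Pn; exists i0; rewrite inE.
apply: le_trans (max_ratio_le_sum r1 I0).
have := max_ratio_single; have := max_ratio_ge0 [set i0].
set M := max_ratio _; clearbody M => M0 nM.
have n0 : 0 < n%:R :> R.
  rewrite lt_neqAle ler0n andbT; apply: contraTneq nM => <-.
  by rewrite mul0r -ltNge.
have n1 : 1 <= n%:R :> R by rewrite ler1n -(ltr0n R).
rewrite -[leLHS]mul1r ler_pdivrMr//.
have [//|M1] := leP 1 (M * n%:R).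
have : M * n%:R * (M * n%:R) <= M * n%:R * 1.
  by rewrite ler_wpM2l ?mulr_ge0// ltW.
nra.
Qed.

(** Three events cover the configurations within distance r of the level x.
    Either some slice at u exceeds Lam times its norm; or the linear
    coefficients along mode i0 have a small square sum; or, by
    form_perturbation, form u is within t = 2 ^ d * Lam * ratio_sum r *
    frobenius f of x. On the last event, once the first two are excluded, the
    linear coefficients are at most t, being slices themselves, and small_ball
    applies to the form as a linear form in the signs of mode i0. *)
Lemma near_level_prob (r p : nat) (K Lam x : R) :
  (4 * p)%:R <= K -> 1 <= K -> 0 < Lam -> (1 <= r)%N ->
  prob R (near_level r x) <=
  (2 ^ d * n ^ d)%:R * (K ^+ d.-1 / Lam ^+ 2) ^+ p +
  (prob R (fun u => \sum_j coef f i0 j u ^+ 2 < frobenius f ^+ 2 / 2) +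
   2048 * (2 ^+ d * Lam * ratio_sum r)).
Proof.
move=> pK K1 L0 r1.
have [j0 _|none] := pickP 'I_n; last first.
  have := F0; rewrite /frobenius big1 ?sqrtr0 ?ltxx// => i _.
  by have := none (i i0).
have n0 : 0 < n%:R :> R by rewrite ltr0n; exact: leq_trans (ltn_ord j0).
have S0 : 0 < ratio_sum r.
  by apply: lt_le_trans (invn_le_ratio_sum r1); rewrite invr_gt0.
pose t := 2 ^+ d * Lam * ratio_sum r * frobenius f.
have t0 : 0 < t by rewrite !mulr_gt0 ?exprn_gt0.
pose s := [seq (i0, j) | j <- enum 'I_n].
have sum_s (G : vertex -> R) : \sum_(v <- s) G v = \sum_j G (i0, j).
  by rewrite big_map big_enum.
pose good u := [forall j, `|coef f i0 j u| <= t] &&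
  (frobenius f ^+ 2 / 2 <= \sum_j coef f i0 j u ^+ 2).
rewrite -[2 ^+ d * _ * _](mulfK (lt0r_neq0 F0)) -/t -[t * _]/(t / _).
pose small u := \sum_j coef f i0 j u ^+ 2 < frobenius f ^+ 2 / 2.
pose large u := [exists z : {set 'I_d} * index, (z.1 != finset.set0) &&
  (Lam ^+ 2 * \sum_(i | slice_rep j0 z.1 i == z.2) f i ^+ 2
     < slice f j0 z.1 z.2 u ^+ 2)].
pose hit u := good u &&
  (`|\sum_(v <- s) coef f i0 v.2 u * sgn R u v - x| <= t).
apply: (@le_trans _ _ (prob R (fun u => large u || (small u || hit u)))).
  apply: prob_sub => u /existsP[u' /andP[uu' /eqP ux]].
  have [//|/existsPn lg] := boolP (large u) => /=.
  rewrite /small; case: ltP => //= Fc.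
  have sl I e : I != finset.set0 ->
      `|slice f j0 I e u| <= Lam * (frobenius f * max_ratio I).
    move=> I0; have := lg (I, e); rewrite I0 /= -leNgt => sI.
    rewrite -(@ler_pXn2r _ 2) ?nnegrE ?mulr_ge0 ?max_ratio_ge0
      ?(ltW L0) ?(ltW F0)//.
    rewrite real_normK ?num_real// (le_trans sI)// exprMn.
    by rewrite ler_wpM2l ?sqr_ge0// slice_norm_sqr_le.
  rewrite /hit /good Fc andbT; apply/andP; split.
    apply/forallP => j; rewrite (coef_slice f j0).
    have I0 : [set i0] != finset.set0.
      by apply/finset.set0Pn; exists i0; rewrite inE.
    apply: le_trans (sl _ _ I0) _.
    have -> : t = Lam * (frobenius f * (2 ^+ d * ratio_sum r)).
      by rewrite /t; ring.
    rewrite !ler_wpM2l ?(ltW L0) ?(ltW F0)//.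
    apply: le_trans (max_ratio_le_sum r1 I0) _.
    by rewrite ler_peMl ?(ltW S0)// exprn_ege1// ler1n.
  rewrite sum_s -form_coef -ux distrC.
  apply: le_trans (form_perturbation sl uu') _.
  rewrite /t /ratio_sum mulr_sumr mulr_suml; apply: ler_sum => I I0.
  rewrite exprMn.
  have -> : 2 ^+ d * Lam * (r%:R ^+ #|I| * max_ratio I) * frobenius f =
    2 ^+ d * r%:R ^+ #|I| * (Lam * (frobenius f * max_ratio I)) by ring.
  rewrite ler_wpM2r ?mulr_ge0 ?max_ratio_ge0 ?(ltW L0) ?(ltW F0)//.
  rewrite ler_wpM2r ?exprn_ge0// ler_weXn2l ?ler1n//.
  by rewrite -[leqRHS]card_ord max_card.
apply: le_trans (probU _ _ _) _; apply: lerD.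
  by apply: slices_tail => //; rewrite exprn_gt0.
apply: le_trans (probU _ _ _) _; apply: lerD => //.
apply: small_ball => //.
- by rewrite map_inj_uniq ?enum_uniq// => j j' [].
- move=> _ u /mapP[j _ ->]; rewrite /good.
  congr (_ && _); first by apply: eq_forallb => j'; rewrite coef_flip.
  by congr (_ <= _); apply: eq_bigr => j' _; rewrite coef_flip.
- by move=> _ v u /mapP[j _ ->]; rewrite coef_flip.
- by move=> v u /andP[/forallP/(_ v.2)].
- by move=> u /andP[_]; rewrite sum_s.
Qed.

End CubeBound.

(** The square of the constant in front of the logarithm in the threshold
    Lam of near_level_prob: expR d.+1 makes the failure probability of one
    slice at most n ^ - (d + 1), and 8 ^ d comes from the moment order
    4 p <= 8 ln n. *)
Definition moment_const (R : realType) (d : nat) : R :=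
  8 ^+ d * expR d.+1%:R.

Lemma moment_const_gt0 (R : realType) (d : nat) : 0 < moment_const R d.
Proof. by rewrite mulr_gt0 ?exprn_gt0 ?expR_gt0. Qed.

(** With p of order ln n and Lam of order (ln n) ^ (d / 2), the union bound
    over the slices costs at most 2 ^ d / n, which is dominated by the ratio
    sum itself. *)
Lemma near_level_prob_log (R : realType) (d n : nat) (f : tensor R 'I_d n)
    (i0 : 'I_d) (r : nat) (x : R) :
  0 < frobenius f -> (1 <= r)%N -> 1 <= ln (n%:R : R) ->
  prob R (near_level f r x) <=
  2 ^+ d * (1 + 2048 * Num.sqrt (moment_const R d)) * ln n%:R `^ (d%:R / 2)
    * ratio_sum f r +
  prob R (fun u => \sum_j coef f i0 j u ^+ 2 < frobenius f ^+ 2 / 2).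
Proof.
move=> F0 r1; set l := ln _ => l1; set A := moment_const R d.
have A0 : 0 < A by exact: moment_const_gt0.
have l0 : 0 < l by apply: lt_le_trans l1.
have n0 : 0 < n%:R :> R.
  by rewrite ltNge; apply/negP => n0; move: l1; rewrite /l ln0// ler10.
pose p := (Num.truncn l).+1.
have lp : l <= p%:R by apply: ltW; exact: truncnS_gt.
have pl : p%:R <= l + 1 by rewrite /p -natr1 lerD2r truncn_le ltW.
pose Lam := Num.sqrt A * l `^ (d%:R / 2).
have Lam0 : 0 < Lam by rewrite mulr_gt0 ?sqrtr_gt0 ?powR_gt0.
have Lam2 : Lam ^+ 2 = A * l ^+ d.
  rewrite exprMn sqr_sqrtr ?ltW//.
  rewrite -[(l `^ _) ^+ 2]powR_mulrn ?powR_ge0// -powRrM.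
  by rewrite divfK// powR_mulrn// ltW.
have K1 : 1 <= (4 * p)%:R :> R by rewrite ler1n.
apply: le_trans (near_level_prob i0 F0 x (lexx _) K1 Lam0 r1) _.
rewrite addrCA addrC lerD2r.
have S0 := invn_le_ratio_sum i0 F0 r1.
have S00 : 0 <= ratio_sum f r by apply: le_trans S0; rewrite invr_ge0.
have l2 : 1 <= l `^ (d%:R / 2) by rewrite -[leLHS](powRr0 l) ler_powR ?divr_ge0.
have ratio : (4 * p)%:R ^+ d.-1 / Lam ^+ 2 <= expR (- d.+1%:R).
  rewrite Lam2 ler_pdivrMr ?mulr_gt0 ?exprn_gt0//.
  have -> : expR (- d.+1%:R) * (A * l ^+ d) = (8 * l) ^+ d.
    by rewrite /A /moment_const exprMn expRN; field; rewrite gt_eqF ?expR_gt0.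
  apply: (@le_trans _ _ ((4 * p)%:R ^+ d)).
    by rewrite ler_weXn2l// leq_pred.
  rewrite lerXn2r ?nnegrE ?mulr_ge0 ?(ltW l0)// natrM.
  lra.
have ratio0 : 0 <= (4 * p)%:R ^+ d.-1 / Lam ^+ 2.
  by rewrite divr_ge0 ?exprn_ge0 ?(ltW Lam0).
have first : (2 ^ d * n ^ d)%:R * ((4 * p)%:R ^+ d.-1 / Lam ^+ 2) ^+ p <=
    2 ^+ d * (l `^ (d%:R / 2) * ratio_sum f r).
  apply: (@le_trans _ _ ((2 ^ d * n ^ d)%:R * expR (- l) ^+ d.+1)).
    rewrite ler_wpM2l//; apply: (@le_trans _ _ (expR (- d.+1%:R) ^+ p)).
      by rewrite lerXn2r ?nnegrE ?expR_ge0.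
    by rewrite -!expRM_natl ler_expR !mulrN lerN2 mulrC ler_wpM2r.
  rewrite expRN lnK ?posrE// natrM !natrX -mulrA ler_wpM2l ?exprn_ge0//.
  rewrite exprS mulrCA -exprMn divff ?gt_eqF// expr1n mulr1.
  apply: le_trans S0 _; rewrite ler_peMl//.
set a := l `^ _ in l2 first *; set S := ratio_sum f r in S00 first *.
have -> : 2048 * (2 ^+ d * Lam * S) = 2 ^+ d * (2048 * Num.sqrt A) * a * S.
  by rewrite /Lam -/a; ring.
have -> : 2 ^+ d * (1 + 2048 * Num.sqrt A) * a * S =
  2 ^+ d * (a * S) + 2 ^+ d * (2048 * Num.sqrt A) * a * S by ring.
by rewrite lerD2r.
Qed.

(** * From the cube to an arbitrary probability space *)

Section Transfer.
Context (R : realType) (d n : nat) (disp : measure_display)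
  (T : measurableType disp) (P : probability T R) (xi : 'I_d -> T -> cube n).
Local Notation vertex := ('I_d * 'I_n)%type.
Implicit Types (u : {ffun vertex -> bool}) (w : T).

Definition pack (v : 'I_d -> cube n) : {ffun vertex -> bool} :=
  [ffun p => v p.1 p.2].

Definition unpack u (k : 'I_d) : cube n := [ffun j => u (k, j)].

Lemma packK v k : unpack (pack v) k = v k.
Proof. by apply/ffunP => j; rewrite !ffunE. Qed.

Lemma unpackK u : pack (unpack u) = u.
Proof. by apply/ffunP => -[k j]; rewrite !ffunE. Qed.

Lemma rademacher_point (X : T -> cube n) (c : cube n) : rademacher P X ->
  P (X @^-1` [set c])%classic = (2^-1 ^+ n)%:E.
Proof.
move=> [_ indep unif].
have := indep [set: 'I_n] (fun j => [set c j]%classic).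
rewrite (_ : (\bigcap_(j in _) _)%classic = (X @^-1` [set c])%classic).
  move=> ->; rewrite (eq_bigr (fun=> (2^-1)%:E)); last first.
    by move=> j _; exact: unif.
  by rewrite prodEFin prodr_const finset.cardsT card_ord.
apply/seteqP; split => w /=.
  by move=> wc; apply/ffunP => j; apply: wc => /=; rewrite inE.
by move=> <- j.
Qed.

Hypothesis hxi : independent_rademacher P xi.

Lemma pack_point_setE u : [set w | pack (xi^~ w) = u]%classic =
  (\bigcap_(k in [set` [set: 'I_d]%SET]) (xi k @^-1` [set unpack u k]))%classic.
Proof.
apply/seteqP; split => w /=.
  by move=> <- k _ /=; rewrite packK.
move=> wu; rewrite -[RHS]unpackK; apply/ffunP => -[k j]; rewrite !ffunE /=.
by rewrite (wu k)/= ?inE// ffunE.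
Qed.

Lemma measurable_pack_point u : measurable [set w | pack (xi^~ w) = u]%classic.
Proof.
rewrite pack_point_setE; apply: fin_bigcap_measurable => // k _.
by have [+ _] := hxi => /(_ k)[+ _ _]; apply.
Qed.

Lemma pack_point u : P [set w | pack (xi^~ w) = u]%classic =
  (2^-1 ^+ (d * n))%:E.
Proof.
have [rad indep] := hxi.
rewrite pack_point_setE indep.
rewrite (eq_bigr (fun=> (2^-1 ^+ n)%:E)); last first.
  by move=> k _; exact: rademacher_point.
by rewrite prodEFin prodr_const finset.cardsT card_ord -exprM mulnC.
Qed.

Lemma pack_law (Q : pred {ffun vertex -> bool}) :
  P [set w | Q (pack (xi^~ w))]%classic = (prob R Q)%:E.
Proof.
pose s := [seq u <- enum {ffun vertex -> bool} | Q u].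
have -> : [set w | Q (pack (xi^~ w))]%classic =
    (\bigcup_(u in [set` s]) [set w | pack (xi^~ w) = u])%classic.
  apply/seteqP; split => w /=.
    by move=> Qw; exists (pack (xi^~ w)) => //=; rewrite mem_filter Qw mem_enum.
  by move=> [u /=]; rewrite mem_filter => /andP[Qu _] ->.
rewrite measure_fin_bigcup//=; last 2 first.
- by move=> u u' _ _ [w /= [<- <-]].
- by move=> u _; exact: measurable_pack_point.
rewrite -fsbig_seq; last by apply/filter_uniq/enum_uniq.
rewrite /s big_filter big_enum_cond /=.
rewrite (eq_bigr (fun=> (2^-1 ^+ (d * n))%:E)); last first.
  by move=> u _; exact: pack_point.
rewrite sumEFin; congr _%:E.
rewrite /prob /mean mulr_suml big_mkcond; apply: eq_bigr => u _.
rewrite card_ffun card_bool card_prod !card_ord natrX exprVn.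
by case: (Q u); rewrite ?mul1r ?mul0r.
Qed.

End Transfer.

Lemma multilinear_eval_form (R : realType) (d n : nat) (f : tensor R 'I_d n)
    (v : 'I_d -> cube n) :
  multilinear_eval f (fun k => sign_vector R (v k)) = form f (pack v).
Proof.
apply: eq_bigr => i _; congr (_ * _); apply: eq_bigr => k _.
by rewrite mxE /sgn ffunE.
Qed.

(** The infimum is over natural numbers, so it is at most r exactly when it is
    less than r + 1, and then some configuration of the level set is within
    distance r. *)
Lemma resilience_leE (R : realType) (d n : nat) (f : tensor R 'I_d n) (x : R)
    (v : 'I_d -> cube n) (r : nat) :
  (resilience f x v <= r%:R%:E)%E = near_level f r x (pack v).
Proof.
apply/idP/existsP => [vr|[u' /andP[ur /eqP ux]]].
  have : (resilience f x v < r.+1%:R%:E)%E.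
    by apply: le_lt_trans vr _; rewrite lte_fin ltr_nat.
  case/ereal_inf_ltP => _ [u ux <-]; rewrite lte_fin ltr_nat ltnS => ur.
  exists (pack u); rewrite -multilinear_eval_form ux eqxx andbT.
  apply: leq_trans ur; apply: subset_leq_card.
  by apply/fintype.subsetP => p; rewrite !inE !ffunE.
apply: (@le_trans _ _ (hamming v (unpack u'))%:R%:E).
  apply: ereal_inf_lbound; exists (unpack u') => //=.
  by rewrite multilinear_eval_form unpackK.
rewrite lee_fin ler_nat; apply: leq_trans ur; apply: subset_leq_card.
by apply/fintype.subsetP => -[k j]; rewrite !inE !ffunE.
Qed.

Unset Implicit Arguments.
Set Strict Implicit.
Set Printing Implicit Defensive.

Theorem theorem1p7 (R : realType) (d : nat) (d_ge2 : (2 <= d)%N) :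
  exists (n0 : nat) (C1 C2 c theta : R),
    [/\ 0 < C1, 0 < C2, 0 < c & 0 < theta] /\
    forall n : nat, (n0 <= n)%N ->
    forall f : tensor R 'I_d n, (exists i, f i <> 0) ->
    forall (disp : measure_display) (T : measurableType disp)
      (P : probability T R) (xi : 'I_d -> T -> cube n),
      independent_rademacher P xi ->
    forall r : nat, (1 <= r <= n)%N ->
    (ereal_sup [set P [set w | resilience f x (fun k => xi k w) <= r%:R%:E]%classic
               | x in [set: R]]%classic
     <= (C1 * ln (n%:R : R) `^ (d%:R / 2)
         * \sum_(I : {set 'I_d} | I != finset.set0)
             r%:R ^+ #|I| *
             \big[Num.max/0]_(dI : {ffun {k : 'I_d | k \in I} -> 'I_n})
               (frobenius (restriction f dI) / frobenius f))%:E
        + C2%:E *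
          expeR (- (c%:E * ((frobenius f ^+ 2)%:E / (Gamma f)%:E)
                             `^ theta^-1)))%E.
Proof.
have d0 : (0 < d)%N by apply: leq_trans d_ge2.
pose i0 := Ordinal d0.
(* For n at least this large, 1 <= ln n. *)
exists (Num.truncn (expR 1 : R)).+1.
exists (2 ^+ d * (1 + 2048 * Num.sqrt (moment_const R d))), (expR 1), 128^-1, d%:R.
split.
  split; last by rewrite ltr0n.
  - apply: mulr_gt0; first by rewrite exprn_gt0 ?ltr0n.
    apply: ltr_wpDr ltr01.
    by apply: mulr_ge0; [exact: ler0n|exact: sqrtr_ge0].
  - exact: expR_gt0.
  - by rewrite invr_gt0 ltr0n.
move=> n en f [i /eqP fi] disp T P xi hxi r /andP[r1 _].
have F0 : 0 < frobenius f.
  rewrite sqrtr_gt0; apply: (@lt_le_trans _ _ (f i ^+ 2)).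
    by rewrite lt_neqAle sqr_ge0 andbT eq_sym sqrf_eq0.
  by rewrite (bigD1 i)//= lerDl sumr_ge0// => j _; rewrite sqr_ge0.
have ln1 : 1 <= ln (n%:R : R).
  rewrite -[leLHS]expRK ler_ln ?posrE ?expR_gt0//.
    by apply: le_trans (ltW (truncnS_gt _)) _; rewrite ler_nat.
  by rewrite ltr0n; apply: leq_ltn_trans en.
apply: ge_ereal_sup => _ [x _ <-].
have -> : [set w | (resilience f x (fun k => xi k w) <= r%:R%:E)%E]%classic =
    [set w | near_level f r x (pack (fun k => xi k w))]%classic.
  by apply/seteqP; split => w /=; rewrite resilience_leE.
rewrite (pack_law hxi (near_level f r x)).
have := near_level_prob_log i0 x F0 r1 ln1; rewrite -lee_fin EFinD => near.
apply: le_trans near _; apply: leeD; first exact: lexx.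
have [G0|] := eqVneq (Gamma f) 0.
  rewrite coef_tail_gamma0// G0 inve0.
  by rewrite mule_ge0 ?expeR_ge0// lee_fin expR_ge0.
have := Gamma_ge0 f; rewrite le_eqVlt eq_sym => /orP[-> //|G0 GN].
rewrite inver (negPf GN).
rewrite -[((frobenius f ^+ 2)%:E * _)%E]EFinM poweR_EFin.
by rewrite -[leRHS]EFinM lee_fin; exact: coef_tail_expR.
Qed.
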